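(* Let $g_u$ be defined by $g_u(\cdot)=u^{\frac{4k}{n+2k}}(\cdot)\,|dx|^2$, $u>0$. Then $g_u$ is a conformally flat rotationally symmetric $k$-Yamabe gradient soliton with $\sigma_k(g_u)>0$ if and only if $u$ is a smooth radial solution to the elliptic equation $$\sigma_k^{1/k}\left(D^{2}\big(u^{-\frac{2k}{n+2k}}\big)-\frac{u^{\frac{2k}{n+2k}}}{2}\big|D\big(u^{-\frac{2k}{n+2k}}\big)\big|^{2}I\right)=u^{\frac{2k}{n+2k}-1}\left[(2\theta+\rho)u+\frac{4k\theta}{n+2k}\,x\cdot Du\right],$$ where $\theta$ is a parameter that satisfies $2\theta+\rho>0$. This equation is equivalent to $$D_j\big(D_i u^{-\frac{2k}{n+2k}}\,T^{ij}_{k-1}\big)-n\,u^{\frac{2k}{n+2k}}\,T^{ij}_{k-1}\,D_iu^{-\frac{2k}{n+2k}}\,D_ju^{-\frac{2k}{n+2k}}+u^{\frac{2k}{n+2k}}\,\frac{n-k+1}{2}\,\sigma_{k-1}\,\big|Du^{-\frac{2k}{n+2k}}\big|^2=k\,u^{\frac{k(n-2k)}{n+2k}}\left[(2\theta+\rho)u+\frac{4k\theta}{n+2k}\,x\cdot Du\right]^k,$$ where $T_{k-1}$ is the $(k-1)$-th Newton tensor evaluated on the Schouten tensor $g_u^{-1}A_{g_u}$ (and $\sigma_{k-1}=\sigma_{k-1}(g_u)$). All derivatives and norms are Euclidean.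
   Context: Here $n\ge 3$ and $1\le k\le n$ are integers, $\rho\in\mathbb{R}$ is the soliton constant, $u$ is a positive function on $\mathbb{R}^n$ and $|dx|^2$ is the Euclidean metric. For a Riemannian metric $g$ on an $n$-manifold, the Schouten tensor is $A_g=\frac{1}{n-2}\left(\mathrm{Ric}_g-\frac{R_g}{2(n-1)}g\right)$, with $\mathrm{Ric}_g$ and $R_g$ the Ricci tensor and scalar curvature. For a diagonalizable matrix $\mathbb{A}$ with real eigenvalues $\lambda_1,\dots,\lambda_n$, $\sigma_k(\mathbb{A})=\sum_{i_1<\dots<i_k}\lambda_{i_1}\cdots\lambda_{i_k}$ (with $\sigma_0=1$), and $\sigma_k(g):=\sigma_k(g^{-1}A_g)$. The $k$-th Newton transformation (Newton tensor) is $T_k(\mathbb{A})=\sigma_k(\mathbb{A})I-\sigma_{k-1}(\mathbb{A})\mathbb{A}+\dots+(-1)^k\mathbb{A}^k$. A metric $g$ is a $k$-Yamabe gradient soliton (with constant $\rho$) if there is a smooth potential function $\varphi$ with $(\sigma_k^{1/k}(g)-\rho)\,g=\nabla^2\varphi$, the Hessian being taken with respect to $g$. Summation over repeated indices is used.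
   Formalization: In the divergence-form equation the exponent k(n-2k)/(n+2k) of u on the right is corrected to k(2-n-2k)/(n+2k), and that equation is shown to imply the first one only for u with σ_k(g_u)>0, without which the implication fails (e.g. n=3, k=2). *)

(* Defs.v *)
From HB Require Import structures.
From mathcomp Require Import all_boot all_order all_algebra.
From mathcomp Require Import all_classical all_reals all_analysis.
Set Implicit Arguments.
Unset Strict Implicit.
Unset Printing Implicit Defensive.
Import Order.TTheory GRing.Theory Num.Theory.
Import numFieldNormedType.Exports.
Local Open Scope ring_scope.

(* Points of R^n are row vectors. The library norm `|x| on 'rV[R]_n is the sup
   norm; it only enters through the topology, and the Euclidean norm is enorm. *)

Definition partial (R : realType) (n : nat) (i : 'I_n) (f : 'rV[R]_n -> R) :
  'rV[R]_n -> R := 'D_(delta_mx 0 i) f.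

Definition grad (R : realType) (n : nat) (f : 'rV[R]_n -> R) (x : 'rV[R]_n) :
  'rV[R]_n := \row_i partial i f x.

Definition hess (R : realType) (n : nat) (f : 'rV[R]_n -> R) (x : 'rV[R]_n) :
  'M[R]_n := \matrix_(i, j) partial j (partial i f) x.

(* C^oo: every iterated partial derivative is differentiable everywhere. *)
Definition smooth (R : realType) (n : nat) (f : 'rV[R]_n -> R) : Prop :=
  forall (s : seq 'I_n) (x : 'rV[R]_n),
    differentiable (foldr (@partial R n) f s) x.

Definition dot (R : realType) (n : nat) (x y : 'rV[R]_n) : R :=
  \sum_i x 0 i * y 0 i.

Definition enorm (R : realType) (n : nat) (x : 'rV[R]_n) : R :=
  Num.sqrt (dot x x).

Definition radial (R : realType) (n : nat) (u : 'rV[R]_n -> R) : Prop :=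
  exists f : R -> R, forall x, u x = f (enorm x).

(* The eigenvalues of A, repeated according to multiplicity and in an
   unspecified order; a dummy value if A has an eigenvalue outside R. *)
Definition eigenvalues (R : realType) (n : nat) (A : 'M[R]_n) : 'rV[R]_n :=
  xget 0 [set d : 'rV[R]_n | char_poly A = \prod_i ('X - (d 0 i)%:P)]%classic.

Definition sigma (R : realType) (n k : nat) (A : 'M[R]_n) : R :=
  \sum_(I : {set 'I_n} | #|I| == k) \prod_(i in I) eigenvalues A 0 i.

Definition newton (R : realType) (n k : nat) (A : 'M[R]_n) : 'M[R]_n :=
  \sum_(j < k.+1) ((-1) ^+ j * sigma (k - j) A) *: A ^+ j.

(* s = a^(1/k). For k >= 2 this is the nonnegative root of a >= 0, and there is
   no such s if a < 0; for k = 1 it is s = a for every real a. The library's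
   a `^ k%:R^-1 is not used because it equals 1 for every negative a. *)
Definition is_kth_root (R : realType) (k : nat) (a s : R) : Prop :=
  s ^+ k = a /\ ((1 < k)%N -> 0 <= s).

(* A metric on R^n is given by its matrix in the standard coordinates. *)
Definition is_metric (R : realType) (n : nat) (g : 'rV[R]_n -> 'M[R]_n) : Prop :=
  [/\ forall i j, smooth (fun x => g x i j),
      forall x, (g x)^T = g x &
      forall x (w : 'rV[R]_n), w != 0 -> 0 < (w *m g x *m w^T) 0 0].

(* Gamma^l_ij *)
Definition christoffel (R : realType) (n : nat) (g : 'rV[R]_n -> 'M[R]_n)
    (l i j : 'I_n) (x : 'rV[R]_n) : R :=
  2^-1 * \sum_m invmx (g x) l m *
    (partial i (fun y => g y j m) x + partial j (fun y => g y i m) x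
     - partial m (fun y => g y i j) x).

(* Sign convention: the round sphere has positive Ricci curvature. *)
Definition ricci (R : realType) (n : nat) (g : 'rV[R]_n -> 'M[R]_n)
    (x : 'rV[R]_n) : 'M[R]_n :=
  \matrix_(i, j)
    (\sum_l (partial l (christoffel g l i j) x
             - partial j (christoffel g l i l) x)
     + \sum_l \sum_m (christoffel g l l m x * christoffel g m i j x
                      - christoffel g l j m x * christoffel g m i l x)).

Definition scalar_curv (R : realType) (n : nat) (g : 'rV[R]_n -> 'M[R]_n)
    (x : 'rV[R]_n) : R := \tr (invmx (g x) *m ricci g x).

Definition schouten (R : realType) (n : nat) (g : 'rV[R]_n -> 'M[R]_n)
    (x : 'rV[R]_n) : 'M[R]_n :=
  (n%:R - 2)^-1 *:
    (ricci g x - (scalar_curv g x / (2 * (n%:R - 1))) *: g x).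

Definition mixed_schouten (R : realType) (n : nat) (g : 'rV[R]_n -> 'M[R]_n)
    (x : 'rV[R]_n) : 'M[R]_n := invmx (g x) *m schouten g x.

Definition sigma_metric (R : realType) (n k : nat) (g : 'rV[R]_n -> 'M[R]_n)
    (x : 'rV[R]_n) : R := sigma k (mixed_schouten g x).

Definition hess_metric (R : realType) (n : nat) (g : 'rV[R]_n -> 'M[R]_n)
    (phi : 'rV[R]_n -> R) (x : 'rV[R]_n) : 'M[R]_n :=
  \matrix_(i, j) (partial j (partial i phi) x
                  - \sum_l christoffel g l i j x * partial l phi x).

Definition yamabe_gradient_soliton (R : realType) (n k : nat) (rho : R)
    (g : 'rV[R]_n -> 'M[R]_n) : Prop :=
  is_metric g /\
  exists phi : 'rV[R]_n -> R, smooth phi /\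
    forall x, exists s, is_kth_root k (sigma_metric k g x) s /\
      (s - rho) *: g x = hess_metric g phi x.

Definition conformally_flat (R : realType) (n : nat)
    (g : 'rV[R]_n -> 'M[R]_n) : Prop :=
  exists w : 'rV[R]_n -> R,
    [/\ smooth w, forall x, 0 < w x & forall x, g x = (w x)%:M].

(* Invariance under O(n): the matrix of the pullback of g by x |-> x *m Q is
   Q *m g (x *m Q) *m Q^T. *)
Definition rotationally_symmetric (R : realType) (n : nat)
    (g : 'rV[R]_n -> 'M[R]_n) : Prop :=
  forall Q : 'M[R]_n, Q *m Q^T = 1%:M ->
    forall x, Q *m g (x *m Q) *m Q^T = g x.

(* g_u *)
Definition conf_metric (R : realType) (n k : nat) (u : 'rV[R]_n -> R)
    (x : 'rV[R]_n) : 'M[R]_n :=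
  (u x `^ (4 * k%:R / (n%:R + 2 * k%:R)))%:M.

Definition conf_exp (R : realType) (n k : nat) : R :=
  2 * k%:R / (n%:R + 2 * k%:R).

Definition conf_pow (R : realType) (n k : nat) (u : 'rV[R]_n -> R)
    (x : 'rV[R]_n) : R := u x `^ (- conf_exp R n k).

(* The factor in square brackets, common to both equations. *)
Definition bracket (R : realType) (n k : nat) (rho theta : R)
    (u : 'rV[R]_n -> R) (x : 'rV[R]_n) : R :=
  (2 * theta + rho) * u x
  + 4 * k%:R * theta / (n%:R + 2 * k%:R) * dot x (grad u x).

Definition soliton_eq (R : realType) (n k : nat) (rho theta : R)
    (u : 'rV[R]_n -> R) (x : 'rV[R]_n) : Prop :=
  let a := conf_exp R n k in
  let v := conf_pow k u in
  is_kth_root k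
    (sigma k (hess v x - (u x `^ a / 2 * enorm (grad v x) ^+ 2)%:M))
    (u x `^ (a - 1) * bracket k rho theta u x).

(* The power of u on the right-hand side is the one obtained by raising
   soliton_eq to the power k and multiplying by k u^(-2k(k-1)/(n+2k)):
   k (2k/(n+2k) - 1) - 2k(k-1)/(n+2k) = k (2-n-2k)/(n+2k). *)
Definition soliton_div_eq (R : realType) (n k : nat) (rho theta : R)
    (u : 'rV[R]_n -> R) (x : 'rV[R]_n) : Prop :=
  let a := conf_exp R n k in
  let v := conf_pow k u in
  let W := mixed_schouten (conf_metric k u) in
  let T := fun y => newton k.-1 (W y) in
  \sum_j partial j (fun y => \sum_i partial i v y * T y i j) x
  - n%:R * u x `^ a * (\sum_i \sum_j T x i j * partial i v x * partial j v x)
  + u x `^ a * ((n%:R - k%:R + 1) / 2) * sigma k.-1 (W x)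
    * enorm (grad v x) ^+ 2
  = k%:R * u x `^ (k%:R * (2 - n%:R - 2 * k%:R) / (n%:R + 2 * k%:R))
    * bracket k rho theta u x ^+ k.

(* Main.v *)
(* With v = u^(-2k/(n+2k)) the metric is v^-2 |dx|^2, its mixed Schouten tensor is
   W = v D^2 v - |Dv|^2/2 I, and the equation for u says that sigma_k(W)^(1/k)
   equals s := rho + 2 theta (1 - x.Dv / v).

   If it holds, D phi = 2 theta v^-2 x has a solution because v is radial, and the
   Hessian of phi with respect to g is (s - rho) g. Positivity of sigma_k is not
   given: along a ray s solves an ordinary differential equation, and at a first
   zero of s either Gronwall's lemma or the sign of s' gives a contradiction,
   except when k = 1 and rho > 2 theta > 0, where v would blow up at a finite radius.

   Conversely, the potential of a soliton need not be radial. But on a line through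
   the origin the equations close up into a linear system for its radial
   derivative P and a tangential second derivative Q. After symmetrization under
   t -> -t, t Q = P and v^2 Q is constant, which is the formula for s.

   The divergence form follows from
   v D_j T_m^ij = n T_m^ij D_j v - (n - m) sigma_m D_i v, proved by induction on m
   from the Codazzi equation, and tr(W T_(k-1)) = k sigma_k. In the other
   direction s^k = sigma_k > 0 keeps s away from zero, and s is positive at the
   origin. *)
From HB Require Import structures.
Require Import Defs.
From mathcomp Require Import all_boot all_order all_algebra.
From mathcomp Require Import all_classical all_reals all_analysis.
From mathcomp Require Import complex ring lra.
Set Implicit Arguments.
Unset Strict Implicit.
Unset Printing Implicit Defensive.
Import Order.TTheory GRing.Theory Num.Theory.
Import numFieldNormedType.Exports.
Local Open Scope ring_scope.

(** * Smooth functions *)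

(** [sigma] is defined through eigenvalues, which come unordered and need not be smooth where they
    cross. Hence the facts about sigma_k are drawn from the coefficients of the adjugate of X - A:
    up to sign these are the Newton transformations, and comparing coefficients gives the trace
    formulas and Newton's identities over any commutative ring. The spectral theorem serves only to
    identify [sigma] with coefficients of the characteristic polynomial. Smoothness and derivatives
    of sigma_k then follow by induction from k sigma_k = tr(A T_(k-1)).

    The potential of a soliton is not unique: in the flat case any linear function can be added to
    it. Symmetrizing its derivatives under t -> -t removes such a contribution. The speed s is not
    affected, because it is the positive root of a rotation invariant function and so is invariant
    itself.

    For k >= 2 the root is nonnegative, so a zero of s is a minimum; for k = 1 it need not be, and
    this is why positivity is proved in two cases. *)

Section Calculus.
Context (R : realType) (n : nat).
Implicit Types (f g : 'rV[R]_n -> R) (x : 'rV[R]_n) (i j : 'I_n).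

Lemma partialE f i x : differentiable f x -> partial i f x = 'd f x (delta_mx 0 i).
Proof. by move=> df; rewrite /partial deriveE. Qed.

Lemma partial_cst (c : R) i x : partial i (fun=> c) x = 0.
Proof. exact: derive_cst. Qed.

Lemma partialD f g i x : differentiable f x -> differentiable g x ->
  partial i (fun y => f y + g y) x = partial i f x + partial i g x.
Proof. by move=> df dg; rewrite /partial (@deriveD _ _ _ f g)//; exact: diff_derivable. Qed.

Lemma partialB f g i x : differentiable f x -> differentiable g x ->
  partial i (fun y => f y - g y) x = partial i f x - partial i g x.
Proof. by move=> df dg; rewrite /partial (@deriveB _ _ _ f g)//; exact: diff_derivable. Qed.

Lemma partialM f g i x : differentiable f x -> differentiable g x ->
  partial i (fun y => f y * g y) x = partial i f x * g x + f x * partial i g x.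
Proof.
move=> df dg; rewrite /partial (@deriveM _ _ f g); do ?exact: diff_derivable.
by rewrite addrC /GRing.scale /= [g x * _]mulrC.
Qed.

Lemma differentiable_add f g x : differentiable f x -> differentiable g x ->
  differentiable (fun y => f y + g y) x.
Proof. exact: differentiableD. Qed.

Lemma differentiable_mul f g x : differentiable f x -> differentiable g x ->
  differentiable (fun y => f y * g y) x.
Proof. exact: differentiableM. Qed.

Lemma partial_sum (I : Type) (r : seq I) (P : pred I) (F : I -> 'rV[R]_n -> R) i x :
  (forall k, differentiable (F k) x) ->
  partial i (fun y => \sum_(k <- r | P k) F k y) x =
  \sum_(k <- r | P k) partial i (F k) x.
Proof.
move=> dF; elim: r => [|k r IH].
  rewrite big_nil (_ : (fun y => _) = fun=> 0) ?partial_cst//.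
  by apply/funext => y; rewrite big_nil.
rewrite big_cons -IH; case: ifP => Pk; last first.
  by congr (partial i _ x); apply/funext => y; rewrite big_cons Pk.
rewrite -partialD//; last first.
  elim: r {IH} => [|l r IH].
    rewrite (_ : (fun y => _) = cst 0); first exact: differentiable_cst.
    by apply/funext => y; rewrite big_nil.
  under eq_fun do rewrite big_cons.
  by case: (P l) => //; apply: differentiable_add.
by congr (partial i _ x); apply/funext => y; rewrite big_cons Pk.
Qed.

Lemma differentiable_comp1 (h : R -> R) f x : derivable h (f x) 1 ->
  differentiable f x -> differentiable (fun y => h (f y)) x.
Proof.
by move=> dh df; apply: (differentiable_comp df); exact/derivable1_diffP.
Qed.

Lemma partial_comp1 (h : R -> R) f i x : derivable h (f x) 1 ->
  differentiable f x ->
  partial i (fun y => h (f y)) x = 'D_1 h (f x) * partial i f x.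
Proof.
move=> dh df; have dh' : differentiable h (f x) by exact/derivable1_diffP.
rewrite !partialE//; last exact: differentiable_comp1.
by rewrite (diff_comp df dh')/= diff1E// /GRing.scale/= mulrC derive1E.
Qed.

Lemma differentiable_powR f (a : R) x : differentiable f x -> 0 < f x ->
  differentiable (fun y => f y `^ a) x.
Proof.
move=> df f0; apply: (@differentiable_comp1 (fun z => z `^ a) f) => //.
by apply: derivable_powR; rewrite in_itv/= f0.
Qed.

Lemma partial_powR f (a : R) i x : differentiable f x -> 0 < f x ->
  partial i (fun y => f y `^ a) x = a * f x `^ (a - 1) * partial i f x.
Proof.
move=> df f0; have [dp pE] := is_derive1_powR a f0.
by rewrite (@partial_comp1 (fun z => z `^ a) f)// pE.
Qed.

Lemma partial_coord i j x : partial i (fun y => y 0 j) x = (j == i)%:R.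
Proof.
rewrite partialE; last exact: differentiable_coord.
have -> : 'd (fun y : 'rV[R]_n => y 0 j) x = (fun y => y 0 j) :> (_ -> _).
  have lf : linear (fun y : 'rV[R]_n => y 0 j) by move=> a u v; rewrite !mxE.
  pose L : {linear 'rV[R]_n -> R} := HB.pack (fun y : 'rV[R]_n => y 0 j) (GRing.isLinear.Build _ _ _ _ _ lf).
  by rewrite -[LHS]/('d L x : _ -> _) diff_lin //; exact: coord_continuous.
by rewrite mxE eqxx.
Qed.

Lemma smooth_diff f x : smooth f -> differentiable f x.
Proof. by move/(_ [::]); exact. Qed.

(** [foldr] differentiates by the last index of the list first, so a derivative of [f] taken
    beforehand is appended with [rcons]. *)
Lemma smooth_partial f i : smooth f -> smooth (partial i f).
Proof. by move=> sf s x; have := sf (rcons s i) x; rewrite -cats1 foldr_cat. Qed.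

Lemma smooth_partials f : (forall x, differentiable f x) ->
  (forall i, smooth (partial i f)) -> smooth f.
Proof.
move=> df sf s; case: (lastP s) => [//|{}s i x].
by have := sf i s x; rewrite -cats1 foldr_cat.
Qed.

(** [smooth] is the largest class of differentiable functions closed under partial derivatives. *)
Lemma smooth_coind (P : ('rV[R]_n -> R) -> Prop) :
  (forall f, P f -> (forall x, differentiable f x) /\ (forall i, P (partial i f))) ->
  forall f, P f -> smooth f.
Proof.
move=> HP f Pf s; suff /HP[] : P (foldr (@partial R n) f s) by [].
by elim: s => //= i s /HP[].
Qed.

(* The class of functions obtained from smooth ones by algebraic operations and
   powers is closed under partial derivatives, so coinduction applies to it. *)
Inductive smooth_closure : ('rV[R]_n -> R) -> Prop :=
| SC_base f of smooth f : smooth_closure f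
| SC_cst c : smooth_closure (fun=> c)
| SC_coord i : smooth_closure (fun y => y 0 i)
| SC_add f g of smooth_closure f & smooth_closure g :
    smooth_closure (fun y => f y + g y)
| SC_mul f g of smooth_closure f & smooth_closure g :
    smooth_closure (fun y => f y * g y)
| SC_powR f a of smooth_closure f & (forall x, 0 < f x) :
    smooth_closure (fun y => f y `^ a).

Lemma smooth_closure_diff f x : smooth_closure f -> differentiable f x.
Proof.
elim=> {f} [f|c|i|f g _ df _ dg|f g _ df _ dg|f a _ df f0].
- exact: smooth_diff.
- exact: differentiable_cst.
- exact: differentiable_coord.
- exact: differentiable_add.
- exact: differentiable_mul.
- exact: differentiable_powR.
Qed.

Lemma smooth_closure_smooth f : smooth_closure f -> smooth f.
Proof.
apply: smooth_coind => {}f sf; split=> [x|i]; first exact: smooth_closure_diff.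
elim: sf => {f} [f|c|j|f g sf Pf sg Pg|f g sf Pf sg Pg|f a sf Pf f0].
- by move=> sf; exact/SC_base/smooth_partial.
- rewrite (_ : partial i _ = fun=> 0); first exact: SC_cst.
  by apply/funext => x; exact: partial_cst.
- rewrite (_ : partial i _ = fun=> (j == i)%:R); first exact: SC_cst.
  by apply/funext => x; exact: partial_coord.
- rewrite (_ : partial i _ = fun y => partial i f y + partial i g y); first exact: SC_add.
  by apply/funext => x; rewrite partialD//; exact: smooth_closure_diff.
- rewrite (_ : partial i _ = fun y => partial i f y * g y + f y * partial i g y).
    by apply: SC_add; exact: SC_mul.
  by apply/funext => x; rewrite partialM//; exact: smooth_closure_diff.
- rewrite (_ : partial i _ = fun y => (a * f y `^ (a - 1)) * partial i f y).
    apply: SC_mul => //; apply: SC_mul; first exact: SC_cst.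
    exact: SC_powR.
  by apply/funext => x; rewrite partial_powR//; exact: smooth_closure_diff.
Qed.

Lemma smooth_cst c : smooth (fun _ : 'rV[R]_n => c).
Proof. exact/smooth_closure_smooth/SC_cst. Qed.

Lemma smooth_coord i : smooth (fun y : 'rV[R]_n => y 0 i).
Proof. exact/smooth_closure_smooth/SC_coord. Qed.

Lemma smoothD f g : smooth f -> smooth g -> smooth (fun y => f y + g y).
Proof. by move=> sf sg; apply/smooth_closure_smooth/SC_add; exact: SC_base. Qed.

Lemma smoothM f g : smooth f -> smooth g -> smooth (fun y => f y * g y).
Proof. by move=> sf sg; apply/smooth_closure_smooth/SC_mul; exact: SC_base. Qed.

Lemma smooth_powR f a : smooth f -> (forall x, 0 < f x) -> smooth (fun y => f y `^ a).
Proof. by move=> sf f0; apply/smooth_closure_smooth/SC_powR => //; exact: SC_base. Qed.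

Lemma smoothN f : smooth f -> smooth (fun y => - f y).
Proof.
move=> sf; under eq_fun do rewrite -mulN1r.
by apply: smoothM => //; exact: smooth_cst.
Qed.

Lemma smoothB f g : smooth f -> smooth g -> smooth (fun y => f y - g y).
Proof. by move=> sf sg; apply: smoothD => //; exact: smoothN. Qed.

Lemma smoothV f : smooth f -> (forall x, 0 < f x) -> smooth (fun y => (f y)^-1).
Proof.
move=> sf f0; rewrite (_ : (fun y => _) = fun y => f y `^ (-1)); first exact: smooth_powR.
by apply/funext => y; rewrite powR_inv1// ltW.
Qed.

Lemma smooth_sum (I : Type) (r : seq I) (P : pred I) (F : I -> 'rV[R]_n -> R) :
  (forall k, smooth (F k)) -> smooth (fun y => \sum_(k <- r | P k) F k y).
Proof.
move=> sF; elim: r => [|k r IH].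
  by under eq_fun do rewrite big_nil; exact: smooth_cst.
under eq_fun do rewrite big_cons.
by case: (P k) => //; exact: smoothD.
Qed.

Lemma partialV f i x : (forall y, 0 < f y) -> differentiable f x ->
  partial i (fun y => (f y)^-1) x = - partial i f x / f x ^+ 2.
Proof.
move=> f0 df; rewrite (_ : (fun y => _) = fun y => f y `^ (-1)); last first.
  by apply/funext => y; rewrite powR_inv1// ltW.
rewrite partial_powR// (_ : -1 - 1 = - 2%:R); last by ring.
by rewrite powR_invn ?ltW// mulN1r mulNr mulrC mulNr.
Qed.

End Calculus.

(** A directional derivative sees only the restriction to a line, so two of them agree when the
    restrictions do, even on different spaces and without differentiability. *)
Lemma eq_derive (R : realType) (V W : normedModType R) (f : V -> R) (g : W -> R)
    (a v : V) (b w : W) :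
  (forall h, f (h *: v + a) = g (h *: w + b)) -> 'D_v f a = 'D_w g b.
Proof.
move=> fg; rewrite /derive; set F := fun h => _; set G := fun h => _.
suff -> : F = G by [].
apply/funext => h; rewrite /F /G /= fg; congr (_ *: (_ - _)).
by have := fg 0; rewrite !scale0r !add0r.
Qed.

(** * Directional derivatives and symmetry of second derivatives *)

Section Lines.
Context (R : realType) (n : nat).
Implicit Types (f g : 'rV[R]_n -> R) (x e : 'rV[R]_n) (i j : 'I_n).

Lemma derive_delta f i x : 'D_(delta_mx 0 i) f x = partial i f x.
Proof. by []. Qed.

Lemma derive_partialE f e x : differentiable f x ->
  'D_e f x = \sum_j e 0 j * partial j f x.
Proof.
move=> df; rewrite deriveE// {1}(row_sum_delta e) linear_sum /=.
by apply: eq_bigr => j _; rewrite linearZ /= partialE.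
Qed.

Lemma is_derive_line f x e (t : R) : (forall y, differentiable f y) ->
  is_derive t 1 (fun s : R => f (x + s *: e)) ('D_e f (x + t *: e)).
Proof.
move=> df.
have E : (fun h : R => h^-1 *: (f (x + (h *: 1 + t) *: e) - f (x + t *: e))) =
         (fun h : R => h^-1 *: (f (h *: e + (x + t *: e)) - f (x + t *: e))).
  apply/funext => h; congr (_ *: (f _ - _)).
  by rewrite [h *: 1]mulr1 scalerDl addrCA.
split; last by rewrite /derive /= E.
rewrite /derivable /= E.
exact: (diff_derivable (df _)).
Qed.

Lemma line_MVT f x e (h : R) : (forall y, differentiable f y) -> 0 < h ->
  exists2 s, 0 < s < h & f (x + h *: e) - f x = h * 'D_e f (x + s *: e).
Proof.
move=> df h0.
pose g s := f (x + s *: e).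
have dg (s : R) : is_derive s 1 g ('D_e f (x + s *: e)) by exact: is_derive_line.
have cg : {within `[0, h], continuous g}%classic.
  by apply: derivable_within_continuous => s _; have [] := dg s.
have [r rh] := MVT h0 (fun s _ => dg s) cg.
by rewrite /g scale0r addr0 subr0 mulrC => ->; exists r.
Qed.

Lemma normr_delta_le (i : 'I_n) : `|delta_mx 0 i : 'rV[R]_n| <= 1.
Proof.
rewrite [X in X <= _]mx_normrE; apply/bigmax_leP; split=> // -[a b] _ /=.
by rewrite mxE; case: (_ && _); rewrite ?normr1 ?normr0.
Qed.

Lemma differentiable_shift f x e : differentiable f (x + e) ->
  differentiable (fun z => f (z + e)) x.
Proof.
by move=> df; apply: (@differentiable_comp _ _ _ _ (fun z => z + e) f) => //.

Qed.

Lemma partial_shift f x e i :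
  partial i (fun z => f (z + e)) x = partial i f (x + e).
Proof.
by apply: eq_derive => h; rewrite addrA.
Qed.

(** Mean value theorem twice: along e_i for the increment of [f] by h e_j, then along e_j for the
    i-th partial derivative. *)
Lemma second_difference f x i j (h : R) : smooth f -> 0 < h ->
  exists2 y, `|y - x| < 2 * h &
    f (x + h *: delta_mx 0 i + h *: delta_mx 0 j) - f (x + h *: delta_mx 0 i)
    - (f (x + h *: delta_mx 0 j) - f x) = h * (h * partial j (partial i f) y).
Proof.
move=> sf h0; pose c := h *: delta_mx 0 j : 'rV[R]_n; pose g y := f (y + c) - f y.
have dsh y : differentiable (fun z => f (z + c)) y.
  by apply: differentiable_shift; exact: smooth_diff.
have dg y : differentiable g y.
  by apply: differentiableB; [exact: dsh|exact: smooth_diff].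
have [s /andP[s0 sh] E] := line_MVT x (delta_mx 0 i) dg h0.
rewrite -/c E -/(partial i _ _) partialB//; last exact: smooth_diff.
rewrite partial_shift.
have dp y : differentiable (partial i f) y by exact/smooth_diff/smooth_partial.
have [r /andP[r0 rh] ->] := line_MVT (x + s *: delta_mx 0 i) (delta_mx 0 j) dp h0.
exists (x + s *: delta_mx 0 i + r *: delta_mx 0 j) => //.
rewrite -(addrA x) [x + _]addrC addrK; apply: (le_lt_trans (ler_normD _ _)).
rewrite !normrZ !gtr0_norm// mulr_natl mulr2n; apply: ltrD.
- by apply: le_lt_trans sh; apply: ler_piMr; [exact: ltW|exact: normr_delta_le].
- by apply: le_lt_trans rh; apply: ler_piMr; [exact: ltW|exact: normr_delta_le].
Qed.

Lemma derive_mulmxr m (f : 'rV[R]_m -> R) (Q : 'M[R]_(n, m)) x e :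
  'D_e (fun y => f (y *m Q)) x = 'D_(e *m Q) f (x *m Q).
Proof.
by apply: eq_derive => h; rewrite mulmxDl scalemxAl.
Qed.

Lemma partial_mulmxr (f : 'rV[R]_n -> R) (Q : 'M[R]_n) x i :
  differentiable f (x *m Q) ->
  partial i (fun y => f (y *m Q)) x = \sum_j Q i j * partial j f (x *m Q).
Proof.
move=> df; rewrite /partial derive_mulmxr derive_partialE//.
by apply: eq_bigr => j _; rewrite -rowE mxE.
Qed.

#[local] Opaque partial.

Lemma eq_of_near_coincidence (F G : 'rV[R]_n -> R) x :
  {for x, continuous F} -> {for x, continuous G} ->
  (forall e : R, 0 < e -> exists y z, [/\ `|y - x| < e, `|z - x| < e & F y = G z]) ->
  F x = G x.
Proof.
move=> cF cG FG; apply/eqP/negPn/negP => neq.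
pose d := `|F x - G x| / 2.
have d0 : 0 < d by rewrite divr_gt0// normr_gt0 subr_eq0.
have /cvgrPdist_lt /(_ _ d0) HF := cF; have /cvgrPdist_lt /(_ _ d0) HG := cG.
have /nbhs_normP[e /= e0 He] : \forall y \near x, `|F x - F y| < d /\ `|G x - G y| < d.
  exact: filterI HF HG.
have [y [z [yx zx Eyz]]] := FG _ e0.
have [Fy _] : `|F x - F y| < d /\ `|G x - G y| < d by apply: He; rewrite /ball_ /= distrC.
have [_ Gz] : `|F x - F z| < d /\ `|G x - G z| < d by apply: He; rewrite /ball_ /= distrC.
have : `|F x - G x| <= `|F x - F y| + `|G x - G z|.
  rewrite [X in _ <= _ + X]distrC (_ : F x - G x = (F x - F y) + (G z - G x)).
    exact: ler_normD.
  by rewrite Eyz addrA subrK.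
rewrite leNgt => /negP; apply; apply: lt_le_trans (ltrD Fy Gz) _.
by rewrite /d -splitr.
Qed.

(** The second difference is symmetric in i and j, so the two mixed derivatives take a common value
    at points arbitrarily close to x; continuity concludes. *)
Lemma partialC f i j x : smooth f ->
  partial j (partial i f) x = partial i (partial j f) x.
Proof.
move=> sf; apply: eq_of_near_coincidence.
- by apply/differentiable_continuous/smooth_diff; do 2 apply: smooth_partial.
- by apply/differentiable_continuous/smooth_diff; do 2 apply: smooth_partial.
move=> e e0; have h0 : 0 < e / 2 by rewrite divr_gt0.
have e2 : 2 * (e / 2) = e by rewrite mulrC divfK.
have [y yx Ey] := second_difference x i j sf h0.
have [z zx Ez] := second_difference x j i sf h0.
rewrite e2 in yx zx; exists y, z; split; [exact: yx|exact: zx|].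
have h_neq0 : e / 2 != 0 by rewrite gt_eqF.
suff E2 : e / 2 * (e / 2 * partial j (partial i f) y) =
          e / 2 * (e / 2 * partial i (partial j f) z).
  exact (mulfI h_neq0 (mulfI h_neq0 E2)).
rewrite -[LHS]Ey -[RHS]Ez.
have swap (a b c r : R) : a - b - (c - r) = a - c - (b - r) by ring.
by rewrite swap (addrAC x).
Qed.

Lemma hess_sym f x : smooth f -> (hess f x)^T = hess f x.
Proof. by move=> sf; apply/matrixP => i j; rewrite !mxE partialC. Qed.

End Lines.

(** * Characteristic polynomials and Newton transformations *)

Section CharPoly.
Context (R : comNzRingType).

Lemma coef_prod_XsubC_sum n (d : 'I_n -> R) k : (k <= n)%N ->
  (\prod_i ('X - (d i)%:P))`_(n - k) =
  (-1) ^+ k * \sum_(I : {set 'I_n} | #|I| == k) \prod_(i in I) d i.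
Proof.
move=> kn; pose ps := [tuple d i | i < n].
have E : \prod_i ('X - (d i)%:P) = \prod_(p <- ps) ('X - p%:P).
  by rewrite big_tuple; apply: eq_bigr => i _; rewrite tnth_mktuple.
have := coef_prod_XsubC (ps := ps) (n := (n - k)%N); rewrite E size_tuple => ->.
  rewrite subKn//; congr (_ * _); apply: eq_big => I; first by rewrite inE.
  by move=> _; apply: eq_bigr => i _; rewrite -tnth_nth tnth_mktuple.
exact: leq_subr.
Qed.

Lemma deriv_prod (I : finType) (F : I -> {poly R}) :
  (\prod_i F i)^`() = \sum_i \prod_j (if j == i then (F j)^`() else F j).
Proof.
elim: (index_enum I) (index_enum_uniq I) => [_|i r IH /= /andP[ir ur]].
  by rewrite !big_nil -polyC1 derivC.
rewrite !big_cons derivM IH// eqxx; congr (_ + _).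
  congr (_ * _); apply: eq_big_seq => j jr.
  by case: eqP jr ir => // -> ->.
rewrite big_distrr /=; apply: eq_big_seq => j jr.
rewrite big_cons; case: eqP => // ij; by rewrite ij jr in ir.
Qed.

(** Jacobi's formula: the Leibniz expansion gives a sum of determinants with one row differentiated,
    and expanding along that row produces the cofactors. *)
Lemma deriv_det n (A : 'M[{poly R}]_n) :
  (\det A)^`() = \tr (\adj A *m map_mx (@deriv R) A).
Proof.
pose B i : 'M[{poly R}]_n := \matrix_(a, b) if a == i then (A a b)^`() else A a b.
transitivity (\sum_i \det (B i)).
  rewrite /(\det A) raddf_sum exchange_big /=; apply: eq_bigr => s _.
  rewrite -mulr_sumr.
  have -> (b : bool) (p : {poly R}) : ((-1) ^+ b * p)^`() = (-1) ^+ b * p^`().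
    by case: b; rewrite ?expr0 ?expr1 ?mul1r ?mulN1r ?derivN.
  congr (_ * _).
  under [RHS]eq_bigr do under eq_bigr do rewrite mxE.
  exact: deriv_prod.
rewrite /mxtrace; under [RHS]eq_bigr do rewrite mxE.
rewrite [RHS]exchange_big /=; apply: eq_bigr => i _.
rewrite (expand_det_row _ i). apply: eq_bigr => j _.
rewrite !mxE eqxx mulrC; congr (_ * _); rewrite /cofactor; congr (_ * \det _).
by apply/matrixP => a b; rewrite !mxE eq_sym (negPf (neq_lift _ _)).
Qed.

Variables (n : nat) (A : 'M[R]_n).

(* The coefficients of the adjugate of X - A: up to sign, the Newton
   transformations of A in reverse order. *)
Let N (i : nat) : 'M[R]_n := map_mx (coefp i) (\adj (char_poly_mx A)).

Let adj_coef0 : - (A *m N 0) = ((char_poly A)`_0)%:M.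
Proof.
have /matrixP E := mul_mx_adj (char_poly_mx A).
apply/matrixP => a b; have := congr1 (coefp 0) (E a b).
rewrite !mxE /= coefMn => <-; rewrite coef_sum -sumrN; apply: eq_bigr => c _.
by rewrite !mxE /= [RHS]coefM big_ord1 coefB coefMn coefX mul0rn coefC sub0r mulNr.
Qed.

(** Coefficient of X^(i+1) in (X - A) adj(X - A) = char_poly(A) I. *)
Let adj_coefS i : N i - A *m N i.+1 = ((char_poly A)`_i.+1)%:M.
Proof.
have /matrixP E := mul_mx_adj (char_poly_mx A).
apply/matrixP => a b; have := congr1 (coefp i.+1) (E a b).
rewrite !mxE /= coefMn => <-; rewrite coef_sum.
transitivity (\sum_c ((a == c)%:R * N i c b - A a c * N i.+1 c b)).
  rewrite sumrB; congr (_ - _); rewrite (bigD1 a)//= eqxx mul1r big1 ?addr0 ?mxE//.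
  by move=> c /negPf; rewrite eq_sym => ->; rewrite mul0r.
apply: eq_bigr => c _; rewrite !mxE /= mulrBl coefB coefCM; congr (_ - _).
by case: (a == c); rewrite ?mulr1n ?mulr0n ?mul0r ?coef0 ?mul1r// coefXM.
Qed.

(** Jacobi's formula for det(X - A), where the derivative of X - A is the identity. *)
Let adj_tr i : (char_poly A)`_i.+1 *+ i.+1 = \tr (N i).
Proof.
rewrite -coef_deriv deriv_det /mxtrace coef_sum; apply: eq_bigr => a _.
rewrite mxE coef_sum [RHS]mxE /= (bigD1 a)//= big1 ?addr0.
  by rewrite !mxE eqxx mulr1n derivB derivX derivC subr0 mulr1.
move=> c /negPf ca; rewrite !mxE ca mulr0n sub0r derivN derivC oppr0 mulr0.
by rewrite coef0.
Qed.

(** Downward induction spares a degree bound for minors: the coefficients vanish eventually, and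
    beyond the degree of the characteristic polynomial [adj_coefS] reads N_i = A N_(i+1). *)
Let N_large i : (n <= i)%N -> N i = 0.
Proof.
pose b := \max_(p : 'I_n * 'I_n) size (\adj (char_poly_mx A) p.1 p.2).
have Nb k : (b <= k)%N -> N k = 0.
  move=> bk; apply/matrixP => a c; rewrite mxE [RHS]mxE /= nth_default//.
  apply: leq_trans bk.
  exact: (leq_bigmax (F := fun p => size (\adj (char_poly_mx A) p.1 p.2)) (a, c)).
move=> ni; elim: {i}(b - i)%N {-2}i (leqnn (b - i)) ni => [|k IH] i bi ni.
  by apply: Nb; rewrite -subn_eq0 -leqn0.
have := adj_coefS i; rewrite nth_default ?size_char_poly// (IH i.+1) ?mulmx0 ?subr0.
- by move=> ->; apply/matrixP => a c; rewrite !mxE mul0rn.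
- by rewrite subnS; case: (b - i)%N bi.
- exact: leqW.
Qed.

(** The m-th elementary symmetric function of the roots, available without splitting the
    polynomial. *)
Definition sgn_coef (m : nat) : R := (-1) ^+ m * (char_poly A)`_(n - m).

(** The coefficients [s] are left free so that the recursion serves both [sigma] and [sgn_coef]. *)
Definition newton_seq (s : nat -> R) (m : nat) : 'M[R]_n :=
  \sum_(j < m.+1) ((-1) ^+ j * s (m - j)%N) *: A ^+ j.

Lemma newton_seq0 s : newton_seq s 0 = (s 0)%:M.
Proof. by rewrite /newton_seq big_ord1 expr0 mul1r expr0 scalemx1. Qed.

Lemma newton_seqS s m : newton_seq s m.+1 = (s m.+1)%:M - A *m newton_seq s m.
Proof.
rewrite /newton_seq big_ord_recl subn0 expr0 mul1r expr0 scalemx1; congr (_ + _).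
rewrite mulmx_sumr -sumrN; apply: eq_bigr => j _.
rewrite !lift0 subSS -scalemxAr -[A *m _]/(A * _) -exprS -scaleNr.
by rewrite exprS mulN1r mulNr.
Qed.

Lemma newton_seq_comm s m : A *m newton_seq s m = newton_seq s m *m A.
Proof.
rewrite /newton_seq mulmx_sumr mulmx_suml; apply: eq_bigr => j _.
by rewrite -scalemxAr -scalemxAl -[A *m _]/(A * _) -[_ *m A]/(_ * A) -exprS -exprSr.
Qed.

Let N_newton m : (m < n)%N -> N (n - m.+1) = (-1) ^+ m *: newton_seq sgn_coef m.
Proof.
elim: m => [|m IH] mn.
  (* Both recursions start from the leading coefficient, because N_n = 0. *)
  have := adj_coefS n.-1; rewrite prednK// (N_large (leqnn n)) mulmx0 subr0 subn1 => ->.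
  by rewrite newton_seq0 /sgn_coef expr0 mul1r subn0 scale1r.
have := adj_coefS (n - m.+2); rewrite -subSn// subSS IH; last exact: ltnW.
move/eqP; rewrite subr_eq => /eqP ->; rewrite newton_seqS scalerBr -scalemxAr.
rewrite exprS mulN1r scaleNr scaleNr opprK; congr (_ + _).
rewrite -scaleNr scale_scalar_mx /sgn_coef exprS mulN1r.
by rewrite mulrA mulrNN -expr2 sqrr_sign mul1r.
Qed.

Lemma newton_seq_tr m : (m < n)%N ->
  \tr (newton_seq sgn_coef m) = sgn_coef m *+ (n - m).
Proof.
move=> mn; have := adj_tr (n - m.+1); rewrite N_newton// mxtraceZ.
rewrite -subSn// subSS => /(congr1 (fun z => (-1) ^+ m * z)).
by rewrite mulrA -expr2 sqrr_sign mul1r => <-; rewrite mulrnAr.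
Qed.

(** This is Cayley-Hamilton, T_n = 0, read off the constant coefficient of the adjugate identity. *)
Lemma newton_seq_last : (0 < n)%N -> A *m newton_seq sgn_coef n.-1 = (sgn_coef n)%:M.
Proof.
move=> n0; have := adj_coef0.
have := @N_newton n.-1; rewrite prednK// subnn => -> //.
rewrite -scalemxAr -scaleNr => /(congr1 (fun z => - (-1) ^+ n.-1 *: z)).
rewrite scalerA mulrNN -expr2 sqrr_sign scale1r => ->.
have -> : - (-1) ^+ n.-1 = (-1) ^+ n :> R by rewrite -mulN1r -exprS prednK.
by rewrite scale_scalar_mx /sgn_coef subnn.
Qed.

(** Take the trace of T_(m+1) = sigma_(m+1) I - A T_m: the factor is n - (n - m - 1) = m + 1. For m
    + 1 = n the trace formula is out of range and [newton_seq_last] replaces it. *)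
Lemma newton_identity m : (m < n)%N ->
  \tr (A *m newton_seq sgn_coef m) = sgn_coef m.+1 *+ m.+1.
Proof.
move=> mn; have [mn'|] := ltnP m.+1 n; last first.
  move=> nm; have Em : n = m.+1 by apply/eqP; rewrite eqn_leq nm.
  have := newton_seq_last (leq_ltn_trans (leq0n m) mn).
  have -> : n.-1 = m by rewrite Em.
  by move=> ->; rewrite mxtrace_scalar -Em.
have := newton_seq_tr mn'; rewrite newton_seqS linearB /= mxtrace_scalar.
move/eqP; rewrite subr_eq addrC -subr_eq -mulrnBr; last exact: leq_subr.
by rewrite subKn// => /eqP <-.
Qed.

Lemma char_poly_conj (P Q B : 'M[R]_n) : P *m Q = 1%:M -> char_poly (P *m B *m Q) = char_poly B.
Proof.
move=> PQ; pose f := @polyC R.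
have PQf : map_mx f P *m map_mx f Q = 1%:M by rewrite -map_mxM PQ map_mx1.
suff E : char_poly_mx (P *m B *m Q) = map_mx f P *m char_poly_mx B *m map_mx f Q.
  rewrite /char_poly E !det_mulmx mulrAC -det_mulmx PQf det1 mul1r//.
rewrite /char_poly_mx mulmxBr mulmxBl !map_mxM; congr (_ - _).
by rewrite scalar_mxC -mulmxA PQf mulmx1.
Qed.

End CharPoly.

(** * Elementary symmetric functions of symmetric real matrices *)

Section SymmetricMatrices.
Context (R : realType) (n : nat).
Implicit Types (A B : 'M[R]_n) (d : 'rV[R]_n).

(** Over the complex numbers A is Hermitian, so the spectral theorem splits the polynomial with real
    roots; the factorization descends because polynomials over R embed in those over R[i]. *)
Lemma sym_char_poly_split A : A^T = A ->
  exists d, char_poly A = \prod_i ('X - (d 0 i)%:P).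
Proof.
move=> As; pose f : {rmorphism R -> R[i]} := real_complex R.
pose B := map_mx f A.
have Bh : B \is hermsymmx.
  apply/is_hermitianmxP; rewrite expr0 scale1r; apply/matrixP => i j.
  rewrite !mxE -[in RHS]As mxE; apply/esym/CrealP.
  by apply/complex_realP; exists (A i j).
have Dr := hermitian_spectral_diag_real Bh.
have /orthomx_spectralP BE := hermitian_normalmx Bh.
pose c := spectral_diag B.
have cE i : c 0 i = f (complex.Re (c 0 i)).
  by apply/esym/RRe_real; have /mxOverP/(_ 0 i) := Dr.
exists (\row_i complex.Re (c 0 i)).
apply: (map_inj_poly (f := f)) => //; first exact: complexI.
rewrite (map_char_poly f) rmorph_prod /= -/B.
transitivity (char_poly (diag_mx c)).
  by rewrite [in LHS]BE char_poly_conj// mulVmx// spectral_unit.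
rewrite char_poly_trig ?diag_mx_is_trig//; apply: eq_bigr => i _.
rewrite rmorphB /= map_polyX map_polyC /= !mxE eqxx mulr1n.
by rewrite [in LHS]cE.
Qed.

(** [eigenvalues] is an arbitrary choice, but its symmetric functions are coefficients of the
    characteristic polynomial. For k > n both sums are empty. *)
Lemma sigmaE A d k : char_poly A = \prod_i ('X - (d 0 i)%:P) ->
  sigma k A = \sum_(I : {set 'I_n} | #|I| == k) \prod_(i in I) d 0 i.
Proof.
move=> Ad; rewrite /sigma.
have Ae : char_poly A = \prod_i ('X - (eigenvalues A 0 i)%:P).
  pose P := [set e : 'rV[R]_n | char_poly A = \prod_i ('X - (e 0 i)%:P)]%classic.
  have exP : exists e, P e by exists d.
  exact: (xgetPex 0 exP).
have [kn|nk] := leqP k n.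
  have := coef_prod_XsubC_sum (eigenvalues A 0) kn.
  rewrite -Ae Ad (coef_prod_XsubC_sum (d 0) kn) => /(congr1 (fun z => (-1) ^+ k * z)).
  by rewrite !mulrA -expr2 sqrr_sign !mul1r.
by rewrite !big_pred0// => I; apply/negbTE; rewrite neq_ltn (leq_ltn_trans _ nk)//
  -[X in (_ <= X)%N](card_ord n) max_card.
Qed.

Lemma sigma_char_poly A B k : char_poly A = char_poly B -> sigma k A = sigma k B.
Proof. by rewrite /sigma /eigenvalues => ->. Qed.

Lemma sigma_sgn_coef A k : A^T = A -> (k <= n)%N -> sigma k A = sgn_coef A k.
Proof.
move=> /sym_char_poly_split[d Ad] kn.
rewrite (sigmaE k Ad) /sgn_coef Ad coef_prod_XsubC_sum//.
by rewrite mulrA -expr2 sqrr_sign mul1r.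
Qed.

Lemma sigma0 A : sigma 0 A = 1.
Proof.
rewrite /sigma (big_pred1 finset.set0) ?big_set0// => I /=.
by rewrite cards_eq0.
Qed.

Lemma newtonE m A : newton m A = \sum_(j < m.+1) ((-1) ^+ j * sigma (m - j) A) *: A ^+ j.
Proof. by []. Qed.

Lemma newton0 A : newton 0 A = 1%:M.
Proof. by rewrite [LHS](newton_seq0 A (fun k => sigma k A)) sigma0. Qed.

Lemma newtonS m A : newton m.+1 A = (sigma m.+1 A)%:M - A *m newton m A.
Proof. exact: (newton_seqS A (fun k => sigma k A)). Qed.

Lemma newtonC m A : A *m newton m A = newton m A *m A.
Proof. exact: (newton_seq_comm A (fun k => sigma k A)). Qed.

Lemma newton_sym m A : A^T = A -> (newton m A)^T = newton m A.
Proof.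
move=> As; elim: m => [|m IH]; first by rewrite newton0 trmx1.
by rewrite newtonS linearB /= tr_scalar_mx trmx_mul As IH newtonC.
Qed.

Lemma newton_sgn_coef m A : A^T = A -> (m <= n)%N ->
  newton m A = newton_seq A (sgn_coef A) m.
Proof.
move=> As mn; apply: eq_bigr => j _; rewrite sigma_sgn_coef//.
exact: leq_trans (leq_subr _ _) mn.
Qed.

Lemma newton_tr m A : A^T = A -> (m < n)%N ->
  \tr (newton m A) = (n - m)%:R * sigma m A.
Proof.
move=> As mn; rewrite newton_sgn_coef ?sigma_sgn_coef//; try exact: ltnW.
by rewrite newton_seq_tr// mulr_natl.
Qed.

Lemma newton_trM m A : A^T = A -> (m < n)%N ->
  \tr (A *m newton m A) = m.+1%:R * sigma m.+1 A.
Proof.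
move=> As mn; rewrite newton_sgn_coef ?sigma_sgn_coef//; last exact: ltnW.
by rewrite newton_identity// mulr_natl.
Qed.

Lemma sigma_rec m A : A^T = A -> (m < n)%N ->
  sigma m.+1 A = m.+1%:R^-1 * \tr (A *m newton m A).
Proof. by move=> As mn; rewrite newton_trM// mulKf// pnatr_eq0. Qed.

Lemma sigmaZ c m A : A^T = A -> (m <= n)%N -> sigma m (c *: A) = c ^+ m * sigma m A.
Proof.
move=> As; have cAs : (c *: A)^T = c *: A by rewrite linearZ /= As.
(* sigma_(m+1) is a trace of A T_m, so sigma and T have to be scaled in one induction. *)
suff H : (m <= n)%N -> sigma m (c *: A) = c ^+ m * sigma m A /\
    newton m (c *: A) = c ^+ m *: newton m A by move=> /H[].
elim: m => [_|m IH mn]; first by rewrite !sigma0 !newton0 expr0 mulr1 scale1r.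
have [|_ IHn] := IH; first exact: ltnW.
have E : sigma m.+1 (c *: A) = c ^+ m.+1 * sigma m.+1 A.
  rewrite !sigma_rec// IHn -scalemxAr -scalemxAl scalerA mxtraceZ mulrCA.
  by rewrite exprSr.
split=> //; rewrite !newtonS E scalerBr scale_scalar_mx; congr (_ - _).
by rewrite IHn -scalemxAr -scalemxAl scalerA exprSr.
Qed.

End SymmetricMatrices.

(* Otherwise unification unfolds partial derivatives down to limits of filters. *)
#[local] Opaque partial sigma newton.

(** The bookkeeping for [partial_sigma]: s, p and b stand for sigma_r, tr W^r and tr(W^r dW). The
    left side is the derivative of Newton's identity of order m + 1. Exchanging the sums and using
    the identities of lower order gives b_l the factor m - l, and the second sum adds l + 1. *)
Lemma newton_double_sum (R : comNzRingType) (s p b : nat -> R) (m : nat) :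
  (forall r, (r < m)%N ->
    \sum_(j < r.+1) (-1) ^+ j * s (r - j)%N * p j.+1 = r.+1%:R * s r.+1) ->
  \sum_(j < m) (-1) ^+ j * p j.+1 *
      (\sum_(l < m - j) (-1) ^+ l * s (m - j - l.+1)%N * b l)
    + \sum_(j < m.+1) (-1) ^+ j * s (m - j)%N * (j.+1%:R * b j) =
  m.+1%:R * \sum_(j < m.+1) (-1) ^+ j * s (m - j)%N * b j.
Proof.
move=> H.
have -> : \sum_(j < m) (-1) ^+ j * p j.+1 *
      (\sum_(l < m - j) (-1) ^+ l * s (m - j - l.+1)%N * b l) =
    \sum_(l < m) (-1) ^+ l * b l * ((m - l)%:R * s (m - l)%N).
  transitivity (\sum_(j < m) \sum_(l < m | (l < m - j)%N)
      (-1) ^+ l * b l * ((-1) ^+ j * s (m - j - l.+1)%N * p j.+1)).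
    apply: eq_bigr => j _.
    rewrite (big_ord_widen m (fun l => (-1) ^+ l * s (m - j - l.+1)%N * b l)) ?leq_subr//.
    by rewrite mulr_sumr; apply: eq_bigr => l _; ring.
  rewrite (exchange_big_dep predT)//=; apply: eq_bigr => l _.
  have lm := ltn_ord l.
  have Em : (m - l)%N = (m - l.+1).+1 by rewrite -subSn// subSS.
  rewrite Em -H; last by rewrite ltn_subrL (leq_ltn_trans _ lm).
  rewrite -Em (big_ord_widen m (fun j => (-1) ^+ j * s (m - l.+1 - j)%N * p j.+1)) ?leq_subr//.
  rewrite mulr_sumr; apply: eq_big => [j|j _]; first by rewrite ltn_subRL addnC -ltn_subRL.
  by rewrite -!subnDA addnC.
rewrite [in RHS]big_ord_recr [X in _ + X = _]big_ord_recr /= addrA -big_split /=.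
rewrite mulrDr; congr (_ + _); last by ring.
rewrite mulr_sumr; apply: eq_bigr => l _.
have -> : m.+1%:R = (m - l)%:R + l.+1%:R :> R.
  by rewrite -natrD addnS subnK// ltnW.
ring.
Qed.

(** * Derivatives of sigma_k along a matrix field *)

Section MatrixFields.
Context (R : realType) (n : nat).
Implicit Types (U W : 'rV[R]_n -> 'M[R]_n) (x : 'rV[R]_n) (i j : 'I_n).

Definition smooth_mx W := forall a b, smooth (fun y => W y a b).

Definition partial_mx i W x : 'M[R]_n := \matrix_(a, b) partial i (fun y => W y a b) x.

Lemma smooth_mxM U W : smooth_mx U -> smooth_mx W -> smooth_mx (fun y => U y *m W y).
Proof.
move=> sU sW a b; under eq_fun do rewrite mxE.
by apply: smooth_sum => c; exact: smoothM.
Qed.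

Lemma partial_mxM i U W x : smooth_mx U -> smooth_mx W ->
  partial_mx i (fun y => U y *m W y) x =
  partial_mx i U x *m W x + U x *m partial_mx i W x.
Proof.
move=> sU sW; apply/matrixP => a b; rewrite !mxE.
under eq_fun do rewrite mxE.
rewrite partial_sum; last first.
  by move=> c; apply: smooth_diff; exact: smoothM.
rewrite -big_split; apply: eq_bigr => c _ /=; rewrite !mxE.
by rewrite partialM//; exact: smooth_diff.
Qed.

Lemma smooth_mxX W k : smooth_mx W -> smooth_mx (fun y => W y ^+ k).
Proof.
move=> sW; elim: k => [|k IH].
  by move=> a b; rewrite (_ : (fun y => _) = fun=> (1%:M : 'M[R]_n) a b); [exact: smooth_cst|].
under eq_fun do rewrite exprS; exact: smooth_mxM.
Qed.

Lemma smooth_mxtrace W : smooth_mx W -> smooth (fun y => \tr (W y)).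
Proof. by move=> sW; apply: smooth_sum => a; exact: sW. Qed.

Lemma partial_mxtrace i W x : smooth_mx W ->
  partial i (fun y => \tr (W y)) x = \tr (partial_mx i W x).
Proof.
move=> sW; rewrite partial_sum; last by move=> a; exact: smooth_diff.
by apply: eq_bigr => a _; rewrite mxE.
Qed.

(** The factor W^l carries the induction on k: each factor split off W^(k+1) moves into it, by
    cyclicity of the trace. *)
Lemma tr_partial_mxX i W x (l k : nat) : smooth_mx W ->
  \tr (W x ^+ l *m partial_mx i (fun y => W y ^+ k.+1) x) =
  k.+1%:R * \tr (W x ^+ (l + k) *m partial_mx i W x).
Proof.
move=> sW; elim: k l => [|k IH] l.
  by rewrite addn0 mul1r.
under eq_fun do rewrite exprS.
rewrite partial_mxM//; last exact: smooth_mxX.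
rewrite mulmxDr mxtraceD !mulmxA -[W x ^+ l *m W x]/(_ * _) -exprSr IH.
rewrite mxtrace_mulC mulmxA -[W x ^+ k.+1 *m _]/(_ * _) -exprD addSnnS [(k + _)%N]addnC.
by rewrite -[k.+2%:R]natr1 mulrDl mul1r addSnnS [RHS]addrC.
Qed.

Variable W : 'rV[R]_n -> 'M[R]_n.
Hypotheses (W_sym : forall y, (W y)^T = W y) (sW : smooth_mx W).

(** The recursion expresses sigma_m and T_m polynomially in the entries, which avoids the
    eigenvalues. *)
Lemma smooth_newton m : (m <= n)%N ->
  smooth (fun y => sigma m (W y)) /\ smooth_mx (fun y => newton m (W y)).
Proof.
elim: m => [_|m IH mn].
  split; first by under eq_fun do rewrite sigma0; exact: smooth_cst.
  by move=> a b; under eq_fun do rewrite newton0; exact: smooth_cst.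
have [ss sn] := IH (ltnW mn).
have sWn := smooth_mxM sW sn.
have ssS : smooth (fun y => sigma m.+1 (W y)).
  under eq_fun do rewrite sigma_rec//.
  by apply: smoothM; [exact: smooth_cst|exact: smooth_mxtrace].
split=> // a b.
have -> : (fun y => newton m.+1 (W y) a b) =
  (fun y => sigma m.+1 (W y) * (a == b)%:R - (W y *m newton m (W y)) a b).
  by apply/funext => y; rewrite newtonS 2!mxE mulr_natr [in LHS]mxE.
apply: smoothB; last exact: sWn.
by apply: smoothM => //; exact: smooth_cst.
Qed.

Lemma newton_mulE m x (B : 'M[R]_n) : \tr (newton m (W x) *m B) =
  \sum_(j < m.+1) (-1) ^+ j * sigma (m - j) (W x) * \tr (W x ^+ j *m B).
Proof.
rewrite newtonE mulmx_suml.
rewrite raddf_sum /=; apply: eq_bigr => j _.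
by rewrite -scalemxAl mxtraceZ.
Qed.

Lemma newton_sumE m x : (m < n)%N ->
  \sum_(j < m.+1) (-1) ^+ j * sigma (m - j) (W x) * \tr (W x ^+ j.+1)
  = m.+1%:R * sigma m.+1 (W x).
Proof.
move=> mn; rewrite -newton_trM// newtonC newton_mulE.
by apply: eq_bigr => j _; rewrite exprSr.
Qed.

(** Newton's identity of order m + 1 is differentiated; the derivatives of the lower sigma are known
    by strong induction. *)
Lemma partial_sigma m i x : (m < n)%N ->
  partial i (fun y => sigma m.+1 (W y)) x = \tr (newton m (W x) *m partial_mx i W x).
Proof.
elim/ltn_ind: m => m IH mn.
have m1 : m.+1%:R != 0 :> R by rewrite pnatr_eq0.
have ss k : (k <= n)%N -> smooth (fun y => sigma k (W y)) by move=> /smooth_newton[].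
have sp k : smooth (fun y => \tr (W y ^+ k)) by apply/smooth_mxtrace/smooth_mxX.
apply: (mulfI m1); rewrite newton_mulE.
transitivity (partial i (fun y => m.+1%:R * sigma m.+1 (W y)) x).
  rewrite partialM ?partial_cst ?mul0r ?add0r//.
  exact/smooth_diff/ss.
under eq_fun do rewrite -newton_sumE//.
have sF (j : 'I_m.+1) : smooth (fun y => (-1) ^+ j * sigma (m - j) (W y) * \tr (W y ^+ j.+1)).
  apply: smoothM => //; apply: smoothM; first exact: smooth_cst.
  by apply: ss; exact: leq_trans (leq_subr _ _) (ltnW mn).
rewrite partial_sum; last by move=> j; exact/smooth_diff/sF.
rewrite -(@newton_double_sum _ (fun r => sigma r (W x)) (fun r => \tr (W x ^+ r))
   (fun r => \tr (W x ^+ r *m partial_mx i W x))); last first.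
  by move=> r rm; apply: newton_sumE; exact: ltn_trans mn.
have E (j : 'I_m.+1) : partial i (fun y => (-1) ^+ j * sigma (m - j) (W y) * \tr (W y ^+ j.+1)) x =
   (-1) ^+ j * \tr (W x ^+ j.+1) * partial i (fun y => sigma (m - j) (W y)) x +
   (-1) ^+ j * sigma (m - j) (W x) * (j.+1%:R * \tr (W x ^+ j *m partial_mx i W x)).
  have smj : smooth (fun y => sigma (m - j) (W y)).
    by apply: ss; exact: leq_trans (leq_subr _ _) (ltnW mn).
  rewrite partialM; [|by apply/smooth_diff/smoothM => //; exact: smooth_cst|exact/smooth_diff].
  rewrite partialM; [|exact/smooth_diff/smooth_cst|exact/smooth_diff].
  rewrite partial_cst mul0r add0r mulrAC; congr (_ + _ * _).
  rewrite partial_mxtrace; last exact: smooth_mxX.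
  have := tr_partial_mxX i x 0 j sW.
  by rewrite expr0 mul1mx add0n.
under eq_bigr do rewrite E.
rewrite big_split /=; congr (_ + _).
(* The last term contains the derivative of sigma_0 = 1 and drops out. *)
rewrite big_ord_recr /= subnn.
rewrite (_ : (fun y => sigma 0 (W y)) = fun=> 1); last first.
  by apply/funext => y; rewrite sigma0.
rewrite partial_cst mulr0 addr0; apply: eq_bigr => j _.
have jm := ltn_ord j; congr (_ * _).
have Em : (m - j)%N = (m - j.+1).+1 by rewrite -subSn// subSS.
rewrite Em IH; last 2 first.
- by rewrite ltn_subrL (leq_ltn_trans _ jm).
- by apply: leq_ltn_trans (leq_subr _ _) mn.
rewrite newton_mulE -Em; apply: eq_bigr => l _.
by rewrite -!subnDA addSnnS.
Qed.

End MatrixFields.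

(** * Divergence of the Newton transformations *)

Section NewtonDivergence.
Context (R : realType) (n : nat).
Implicit Types (x : 'rV[R]_n) (i j l : 'I_n).
Variables (v : 'rV[R]_n -> R) (V : 'rV[R]_n -> 'cV[R]_n) (W : 'rV[R]_n -> 'M[R]_n).
Hypotheses (W_sym : forall y, (W y)^T = W y) (sW : smooth_mx W).
(* Codazzi equation of the Schouten tensor, written with the Euclidean
   derivatives of its mixed components. *)
Hypothesis W_codazzi : forall i j l x,
  v x * (partial i (fun y => W y l j) x - partial j (fun y => W y i l) x) =
  V x i 0 * W x l j - V x j 0 * W x i l
  - (W x *m V x) i 0 * (l == j)%:R + (W x *m V x) j 0 * (i == l)%:R.

Let sT m : (m <= n)%N -> smooth_mx (fun y => newton m (W y)).
Proof. by move=> /(smooth_newton W_sym sW)[]. Qed.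

Lemma partial_newtonS m i j x : (m < n)%N ->
  partial j (fun y => newton m.+1 (W y) i j) x =
    (i == j)%:R * partial j (fun y => sigma m.+1 (W y)) x
    - \sum_l (partial j (fun y => W y i l) x * newton m (W x) l j
        + W x i l * partial j (fun y => newton m (W y) l j) x).
Proof.
move=> mn.
have -> : (fun y => newton m.+1 (W y) i j) =
    (fun y => (i == j)%:R * sigma m.+1 (W y) - (W y *m newton m (W y)) i j).
  by apply/funext => y; rewrite newtonS 2!mxE mulr_natl [in LHS]mxE.
have [ss _] := smooth_newton W_sym sW mn.
have sM := smooth_mxM sW (sT (ltnW mn)).
rewrite partialB; last exact/smooth_diff/sM; last first.
  by apply/smooth_diff/smoothM => //; exact: smooth_cst.
rewrite partialM; last exact/smooth_diff; last exact/smooth_diff/smooth_cst.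
rewrite partial_cst mul0r add0r; congr (_ - _).
have := partial_mxM j x sW (sT (ltnW mn)).
move=> /(congr1 (fun B : 'M[R]_n => B i j)).
rewrite mxE => ->; rewrite 3!mxE -big_split /=.
by apply: eq_bigr => l _; rewrite !mxE.
Qed.

Lemma newton_divergence m i x : (m < n)%N ->
  v x * \sum_j partial j (fun y => newton m (W y) i j) x =
  n%:R * (newton m (W x) *m V x) i 0 - (n - m)%:R * sigma m (W x) * V x i 0.
Proof.
elim: m i => [|m IH] i mn.
  rewrite big1 ?mulr0; last first.
    by move=> j _; under eq_fun do rewrite newton0; exact: partial_cst.
  by rewrite newton0 mul1mx sigma0 subn0 mulr1 subrr.
have mn' := ltnW mn.
under eq_bigr do rewrite partial_newtonS//.
rewrite sumrB (bigD1 i)//= eqxx mul1r big1 ?addr0; last first.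
  by move=> j /negPf; rewrite eq_sym => ->; rewrite mul0r.
rewrite partial_sigma//.
set T := newton m (W x).
have Tsym : T^T = T by exact: newton_sym.
have TE a b : T a b = T b a by rewrite -[in RHS]Tsym mxE.
have TW : T *m W x = W x *m T by rewrite newtonC.
have -> : \tr (T *m partial_mx i W x) = \sum_j \sum_l T l j * partial i (fun y => W y l j) x.
  rewrite /mxtrace; apply: eq_bigr => j _; rewrite mxE.
  by apply: eq_bigr => l _; rewrite mxE TE.
(* The derivatives of sigma_(m+1) and of W are both contracted with T_m; together they form the
   antisymmetrized derivative in the Codazzi equation. What remains is W applied to the divergence
   of T_m. *)
transitivity (\sum_j \sum_l T l j * (v x *
     (partial i (fun y => W y l j) x - partial j (fun y => W y i l) x))
   - \sum_l W x i l * (v x * \sum_j partial j (fun y => newton m (W y) l j) x)).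
  have -> : \sum_l W x i l * (v x * \sum_j partial j (fun y => newton m (W y) l j) x)
     = v x * \sum_j \sum_l W x i l * partial j (fun y => newton m (W y) l j) x.
    rewrite exchange_big mulr_sumr; apply: eq_bigr => l _.
    by rewrite mulrCA; congr (_ * _); rewrite mulr_sumr.
  have -> : \sum_j \sum_l T l j * (v x *
     (partial i (fun y => W y l j) x - partial j (fun y => W y i l) x)) =
     v x * (\sum_j \sum_l T l j * partial i (fun y => W y l j) x
           - \sum_j \sum_l partial j (fun y => W y i l) x * T l j).
    rewrite -sumrB mulr_sumr; apply: eq_bigr => j _.
    by rewrite -sumrB mulr_sumr; apply: eq_bigr => l _; ring.
  rewrite -mulrBr; congr (_ * _).
  by under [in LHS]eq_bigr do rewrite big_split /=; rewrite big_split /= opprD addrA.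
under eq_bigr do under eq_bigr do rewrite W_codazzi.
under [X in _ - X]eq_bigr do rewrite IH//.
have -> : \sum_j \sum_l T l j * (V x i 0 * W x l j - V x j 0 * W x i l
    - (W x *m V x) i 0 * (l == j)%:R + (W x *m V x) j 0 * (i == l)%:R) =
  V x i 0 * \tr (W x *m T) - (W x *m T *m V x) i 0 - (W x *m V x) i 0 * \tr T
  + (T *m W x *m V x) i 0.
  rewrite -[T *m _ *m _]mulmxA /mxtrace [(T *m (W x *m V x)) i 0]mxE [(W x *m T *m V x) i 0]mxE.
  rewrite !mulr_sumr -!sumrB -big_split /=; apply: eq_bigr => j _.
  rewrite [(W x *m T) j j]mxE [(W x *m T) i j]mxE mulr_sumr mulr_suml.
  transitivity (\sum_l (V x i 0 * (W x j l * T l j) - W x i l * T l j * V x j 0) -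
    \sum_l (W x *m V x) i 0 * T l j * (l == j)%:R + \sum_l T l j * (W x *m V x) j 0 * (i == l)%:R).
    rewrite -sumrB -big_split /=; apply: eq_bigr => l _.
    have -> : W x j l = W x l j by rewrite -[in LHS]W_sym mxE.
    ring.
  rewrite sumrB; congr (_ - _ + _).
    by rewrite (bigD1 j)//= eqxx mulr1 big1 ?addr0// => l /negPf ->; rewrite mulr0.
  rewrite (bigD1 i)//= eqxx mulr1 big1 ?addr0// => l /negPf; rewrite eq_sym => ->.
  by rewrite mulr0.
(* The terms sigma_m W V from tr T_m and from the induction hypothesis cancel, and so do W T V and T
   W V. *)
rewrite TW newton_trM// newton_tr// newtonS -/T.
have -> : \sum_l W x i l * (n%:R * (T *m V x) l 0 - (n - m)%:R * sigma m (W x) * V x l 0) =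
   n%:R * (W x *m T *m V x) i 0 - (n - m)%:R * sigma m (W x) * (W x *m V x) i 0.
  rewrite -mulmxA !mxE !mulr_sumr -sumrB; apply: eq_bigr => l _; ring.
rewrite mulmxBl mul_scalar_mx [in RHS]mxE [in X in _ * (X + _)]mxE [in X in _ * (_ + X)]mxE.
rewrite !natrB//; last exact: ltnW.
rewrite -[m.+1%:R]natr1; ring.
Qed.

End NewtonDivergence.

Section Divergence.
Context (R : realType) (n : nat).
Implicit Types (x : 'rV[R]_n) (i j : 'I_n).

Lemma dot_ge0 x : 0 <= dot x x.
Proof. by apply: sumr_ge0 => i _; rewrite -expr2 sqr_ge0. Qed.

Lemma sqr_enorm x : enorm x ^+ 2 = dot x x.
Proof. by rewrite sqr_sqrtr// dot_ge0. Qed.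

Definition conf_schouten (v : 'rV[R]_n -> R) (y : 'rV[R]_n) : 'M[R]_n :=
  v y *: hess v y - (dot (grad v y) (grad v y) / 2)%:M.

Variable v : 'rV[R]_n -> R.
Hypothesis sv : smooth v.
Let W := conf_schouten v.
Let V x : 'cV[R]_n := (grad v x)^T.
Let c x := dot (grad v x) (grad v x) / 2.

Lemma smooth_dot_grad : smooth (fun y => dot (grad v y) (grad v y)).
Proof.
apply: smooth_sum => i; under eq_fun do rewrite !mxE.
by apply: smoothM; exact: smooth_partial.
Qed.

Lemma partial_dot_grad j x :
  partial j (fun y => dot (grad v y) (grad v y)) x = 2 * (hess v x *m V x) j 0.
Proof.
rewrite partial_sum; last first.
  move=> i; under eq_fun do rewrite !mxE.
  by apply/smooth_diff/smoothM; exact: smooth_partial.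
rewrite mxE mulr_sumr; apply: eq_bigr => i _; rewrite !mxE.
under eq_fun do rewrite !mxE.
rewrite partialM; try exact/smooth_diff/smooth_partial.
by rewrite (partialC i j)//; ring.
Qed.

Lemma conf_schouten_sym y : (W y)^T = W y.
Proof. by rewrite /W /conf_schouten linearB linearZ /= hess_sym// tr_scalar_mx. Qed.

Let sH a b : smooth (fun y => hess v y a b).
Proof. by under eq_fun do rewrite mxE; do 2 apply: smooth_partial. Qed.

Let WE a b : (fun y => W y a b) = (fun y => v y * hess v y a b -
    dot (grad v y) (grad v y) * ((a == b)%:R / 2)).
Proof. by apply/funext => y; rewrite !mxE -mulr_natr; ring. Qed.

Lemma smooth_conf_schouten : smooth_mx W.
Proof.
move=> a b; rewrite WE; apply: smoothB; apply: smoothM => //.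
  exact: smooth_dot_grad.
exact: smooth_cst.
Qed.

Let partial_W k a b x : partial k (fun y => W y a b) x =
  partial k v x * hess v x a b + v x * partial k (fun y => hess v y a b) x -
  (hess v x *m V x) k 0 * (a == b)%:R.
Proof.
rewrite WE partialB; last first.
- by apply/smooth_diff/smoothM; [exact: smooth_dot_grad|exact: smooth_cst].
- by apply/smooth_diff/smoothM.
rewrite !partialM; try exact/smooth_diff; try exact/smooth_diff/smooth_cst;
  try exact/smooth_diff/smooth_dot_grad.
by rewrite !partial_cst partial_dot_grad; field.
Qed.

Lemma conf_schouten_hess a b x : v x * hess v x a b = W x a b + c x * (a == b)%:R.
Proof. by rewrite [W x a b](congr1 (fun f => f x) (WE a b)) /c; ring. Qed.

Let vHV i x : v x * (hess v x *m V x) i 0 = (W x *m V x) i 0 + c x * V x i 0.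
Proof.
rewrite [in LHS]mxE mulr_sumr.
under eq_bigr do rewrite mulrA conf_schouten_hess mulrDl.
rewrite big_split /= mxE; congr (_ + _); rewrite (bigD1 i)//= big1 ?addr0.
  by rewrite eqxx mulr1.
by move=> j /negPf ji; rewrite eq_sym ji /= mulr0 mul0r.
Qed.

(** Third derivatives of [v] are symmetric and cancel. The factor v turns the remaining Hessians
    into W + c I, and the contributions of c cancel. *)
Lemma codazzi i j l x :
  v x * (partial i (fun y => W y l j) x - partial j (fun y => W y i l) x) =
  V x i 0 * W x l j - V x j 0 * W x i l
  - (W x *m V x) i 0 * (l == j)%:R + (W x *m V x) j 0 * (i == l)%:R.
Proof.
rewrite !partial_W.
have -> : partial i (fun y => hess v y l j) x = partial j (fun y => hess v y i l) x.
  have -> : (fun y => hess v y l j) = partial j (partial l v).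
    by apply/funext => y; rewrite mxE.
  have -> : (fun y => hess v y i l) = partial i (partial l v).
    by apply/funext => y; rewrite mxE partialC.
  by rewrite partialC//; exact: smooth_partial.
transitivity (partial i v x * (v x * hess v x l j) - partial j v x * (v x * hess v x i l)
  - (v x * (hess v x *m V x) i 0) * (l == j)%:R + (v x * (hess v x *m V x) j 0) * (i == l)%:R).
  by ring.
rewrite !conf_schouten_hess !vHV.
have Vi a : V x a 0 = partial a v x by rewrite !mxE.
by rewrite !Vi; ring.
Qed.

End Divergence.

(** Product rule. With m = k - 1, the part v tr(T D^2 v) contributes k sigma_k plus half of (n - m)
    sigma_m |Dv|^2, and the divergence of T subtracts the whole of it. *)
Lemma divergence_newton_grad (R : realType) (n : nat) (v : 'rV[R]_n -> R) m x :
  smooth v -> (m < n)%N ->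
  let W := conf_schouten v in
  v x * (\sum_j partial j (fun y => \sum_i partial i v y * newton m (W y) i j) x) =
  m.+1%:R * sigma m.+1 (W x)
  + n%:R * (\sum_i \sum_j newton m (W x) i j * partial i v x * partial j v x)
  - (n - m)%:R / 2 * sigma m (W x) * dot (grad v x) (grad v x).
Proof.
move=> sv mn W.
have Wsym y : (W y)^T = W y by exact: conf_schouten_sym.
have sW : smooth_mx W by exact: smooth_conf_schouten.
have cW := codazzi sv; have hW := conf_schouten_hess v; rewrite -/W in cW hW.
clearbody W.
have [ss sT] := smooth_newton Wsym sW (ltnW mn).
have E j : partial j (fun y => \sum_i partial i v y * newton m (W y) i j) x =
    \sum_i (hess v x i j * newton m (W x) i j +
      partial i v x * partial j (fun y => newton m (W y) i j) x).
  rewrite partial_sum; last first.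
    by move=> i; apply/smooth_diff/smoothM => //; exact: smooth_partial.
  apply: eq_bigr => i _; rewrite partialM.
  - by rewrite mxE.
  - exact/smooth_diff/smooth_partial.
  - exact/smooth_diff/sT.
under eq_bigr do rewrite E big_split /=.
rewrite big_split /= mulrDr.
set T := newton m (W x).
have Tsym : T^T = T by exact: newton_sym.
have -> : v x * (\sum_j \sum_i hess v x i j * T i j) =
    m.+1%:R * sigma m.+1 (W x) + dot (grad v x) (grad v x) / 2 * ((n - m)%:R * sigma m (W x)).
  rewrite -newton_trM// -newton_tr// -/T /mxtrace !mulr_sumr -big_split /=.
  apply: eq_bigr => j _; rewrite mxE mulr_sumr.
  transitivity (\sum_i (W x j i * T i j +
      dot (grad v x) (grad v x) / 2 * (i == j)%:R * T i j)).
    apply: eq_bigr => i _; rewrite mulrA hW// mulrDl.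
    by congr (_ * _ + _); have /matrixP/(_ i j) := Wsym x; rewrite mxE => ->.
  rewrite big_split /=; congr (_ + _).
  rewrite (bigD1 j)//= eqxx mulr1 big1 ?addr0// => i /negPf ->.
  by rewrite mulr0 mul0r.
have -> : v x * (\sum_j \sum_i partial i v x * partial j (fun y => newton m (W y) i j) x) =
    \sum_i partial i v x * (v x * \sum_j partial j (fun y => newton m (W y) i j) x).
  rewrite exchange_big mulr_sumr; apply: eq_bigr => i _.
  by rewrite -mulr_sumr mulrCA.
have -> : \sum_i partial i v x * (v x * \sum_j partial j (fun y => newton m (W y) i j) x) =
   n%:R * (\sum_i \sum_j T i j * partial i v x * partial j v x)
   - (n - m)%:R * sigma m (W x) * dot (grad v x) (grad v x).
  have nd i := newton_divergence Wsym sW cW i x mn.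
  move: (sigma m (W x)) nd => s nd; rewrite /dot !mulr_sumr -sumrB; apply: eq_bigr => i _.
  rewrite nd -/T.
  have gE a : grad v x 0 a = partial a v x by rewrite mxE.
  rewrite [(T *m _) i 0]mxE [(grad v x)^T i 0]mxE !gE.
  rewrite mulrBr; congr (_ - _); last by ring.
  rewrite mulrCA; congr (_ * _); rewrite mulr_sumr; apply: eq_bigr => j _.
  by rewrite [(grad v x)^T j 0]mxE gE; ring.
by field.
Qed.

(** * Curvature of conformally flat metrics *)

Section ConformalCurvature.
Context (R : realType) (n : nat).
Implicit Types (x : 'rV[R]_n) (i j l m : 'I_n).

Lemma sum_delta (F : 'I_n -> R) i : \sum_j (j == i)%:R * F j = F i.
Proof.
rewrite (bigD1 i)//= eqxx mul1r big1 ?addr0// => j /negPf ->.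
by rewrite mul0r.
Qed.

(** The Christoffel symbols of v^-2 |dx|^2 for q = D log v. They are linear in q, so their
    derivatives are the same expression in the derivatives of q. *)
Definition conf_christoffel (q : 'I_n -> R) l i j : R :=
  q l * (i == j)%:R - q i * (j == l)%:R - q j * (i == l)%:R.

Lemma conf_christoffel_low (q X : 'I_n -> R) i j :
  \sum_l conf_christoffel q l i j * X l =
  (i == j)%:R * (\sum_l q l * X l) - q i * X j - q j * X i.
Proof.
rewrite mulr_sumr -(sum_delta X j) -(sum_delta X i) !mulr_sumr -!sumrB.
by apply: eq_bigr => l _; rewrite /conf_christoffel ![_ == l]eq_sym; ring.
Qed.

Lemma conf_christoffel_up (q X : 'I_n -> R) l j :
  \sum_m conf_christoffel q l j m * X m =
  q l * X j - q j * X l - (j == l)%:R * (\sum_m q m * X m).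
Proof.
rewrite mulr_sumr -(sum_delta X j) -(sum_delta X l) !mulr_sumr -!sumrB.
by apply: eq_bigr => m _; rewrite /conf_christoffel ![j == m]eq_sym; ring.
Qed.

(** The quadratic part of the Ricci tensor; [conf_christoffel_tr] and [conf_christoffel_div] supply
    the part with derivatives. *)
Lemma conf_christoffel_quadratic (q : 'I_n -> R) i j :
  \sum_l \sum_m (conf_christoffel q l l m * conf_christoffel q m i j
               - conf_christoffel q l j m * conf_christoffel q m i l) =
  (n%:R - 2) * (q i * q j - (i == j)%:R * (\sum_l q l * q l)).
Proof.
set Q := \sum_l q l * q l.
under eq_bigr do rewrite sumrB !conf_christoffel_up eqxx mul1r.
transitivity (\sum_l (- (\sum_m q m * conf_christoffel q m i j)
   + (q j * conf_christoffel q l i l - q l * conf_christoffel q j i l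
   + (j == l)%:R * (\sum_m q m * conf_christoffel q m i l)))).
  by apply: eq_bigr => l _; rewrite subrr sub0r; congr (_ + _); rewrite !opprB addrC.
have F a b : \sum_m q m * conf_christoffel q m a b = (a == b)%:R * Q - 2 * (q a * q b).
  transitivity (\sum_m conf_christoffel q m a b * q m).
    by apply: eq_bigr => m _; rewrite mulrC.
  by rewrite conf_christoffel_low -/Q; ring.
under eq_bigr do rewrite !F.
rewrite !big_split /= sumr_const card_ord -mulr_natl.
have -> : \sum_l (j == l)%:R * ((i == l)%:R * Q - 2 * (q i * q l)) =
   (i == j)%:R * Q - 2 * (q i * q j).
  by under eq_bigr do rewrite eq_sym; rewrite sum_delta.
have -> : \sum_l q j * conf_christoffel q l i l = - n%:R * (q i * q j).
  rewrite -mulr_sumr.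
  have -> : \sum_l conf_christoffel q l i l = \sum_(l < n) - q i.
    by apply: eq_bigr => l _; rewrite /conf_christoffel eqxx mulr1; ring.
  by rewrite sumr_const card_ord -mulr_natl; ring.
rewrite sumrN.
have -> : \sum_l q l * conf_christoffel q j i l = q i * q j - q j * q i - (i == j)%:R * Q.
  transitivity (\sum_l conf_christoffel q j i l * q l).
    by apply: eq_bigr => l _; rewrite mulrC.
  by rewrite conf_christoffel_up -/Q; ring.
ring.
Qed.

Lemma conf_christoffel_tr (p : 'I_n -> R) i :
  \sum_l conf_christoffel p l i l = - n%:R * p i.
Proof.
rewrite (eq_bigr (fun=> - p i)).
  by rewrite sumr_const card_ord -mulr_natl; ring.
by move=> l _; rewrite /conf_christoffel eqxx mulr1; ring.
Qed.

Lemma conf_christoffel_div (p : 'I_n -> 'I_n -> R) i j :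
  \sum_l conf_christoffel (p l) l i j =
  (i == j)%:R * (\sum_l p l l) - p j i - p i j.
Proof.
rewrite -(sum_delta (fun l => p l i) j) -(sum_delta (fun l => p l j) i).
rewrite mulr_sumr -!sumrB; apply: eq_bigr => l _; rewrite /conf_christoffel.
by rewrite ![_ == l]eq_sym; ring.
Qed.

Variable v : 'rV[R]_n -> R.
Hypotheses (sv : smooth v) (v_gt0 : forall y, 0 < v y).

Definition inv_sq_metric (y : 'rV[R]_n) : 'M[R]_n := ((v y ^+ 2)^-1)%:M.

Let q x i := partial i v x / v x.

Lemma partial_inv_sq i x :
  partial i (fun y => (v y ^+ 2)^-1) x = - 2 * partial i v x / v x ^+ 3.
Proof.
have v0 : v x != 0 by rewrite gt_eqF.
have sv2 : smooth (fun y => v y ^+ 2) by under eq_fun do rewrite expr2; exact: smoothM.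
rewrite (@partialV _ _ (fun y => v y ^+ 2)); [|by move=> y; rewrite exprn_gt0|exact/smooth_diff].
under eq_fun do rewrite expr2.
rewrite partialM; try exact/smooth_diff.
by field.
Qed.

Lemma smooth_inv_sq : smooth (fun y => (v y ^+ 2)^-1).
Proof.
apply: smoothV; last by move=> y; rewrite exprn_gt0.
by under eq_fun do rewrite expr2; exact: smoothM.
Qed.

Lemma christoffel_inv_sq l i j x :
  christoffel inv_sq_metric l i j x = conf_christoffel (q x) l i j.
Proof.
have v0 : v x != 0 by rewrite gt_eqF.
have dg a b c : partial a (fun y => inv_sq_metric y b c) x =
    - 2 * q x a * (v x ^+ 2)^-1 * (b == c)%:R.
  have -> : - 2 * q x a * (v x ^+ 2)^-1 = partial a (fun y => (v y ^+ 2)^-1) x.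
    by rewrite partial_inv_sq /q; field.
  have -> : (fun y => inv_sq_metric y b c) = (fun y => (v y ^+ 2)^-1 * (b == c)%:R).
    by apply/funext => y; rewrite mxE mulr_natr.
  rewrite partialM ?partial_cst ?mulr0 ?addr0//; first exact/smooth_diff/smooth_inv_sq.
have g0 : v x ^+ 2 != 0 by rewrite expf_neq0.
transitivity (2^-1 * \sum_m (m == l)%:R * (v x ^+ 2 *
  (- 2 * q x i * (v x ^+ 2)^-1 * (j == m)%:R + - 2 * q x j * (v x ^+ 2)^-1 * (i == m)%:R
    - - 2 * q x m * (v x ^+ 2)^-1 * (i == j)%:R))).
  have iE : invmx (inv_sq_metric x) = (v x ^+ 2)%:M.
    by rewrite /inv_sq_metric invmx_scalar invrK.
  rewrite /christoffel iE; congr (_ * _).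
  have E m : ((v x ^+ 2)%:M : 'M[R]_n) l m = (m == l)%:R * v x ^+ 2.
    by rewrite mxE [l == m]eq_sym mulr_natl.
  by apply: eq_bigr => m _; rewrite E !dg [RHS]mulrA.
rewrite sum_delta /conf_christoffel; move: (v x ^+ 2) g0 => g g0.
by field.
Qed.

Let partial_q i j x : partial j (fun y => q y i) x = hess v x i j / v x - q x i * q x j.
Proof.
have v0 : v x != 0 by rewrite gt_eqF.
rewrite /q partialM; last 2 first.
- exact/smooth_diff/smooth_partial.
- exact/smooth_diff/smoothV.
rewrite partialV//; last exact: smooth_diff.
by rewrite mxE; field.
Qed.

Let smooth_q i : smooth (fun y => q y i).
Proof. by apply: smoothM; [exact: smooth_partial|exact: smoothV]. Qed.

Lemma ricci_inv_sq x : ricci inv_sq_metric x =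
  ((n%:R - 2) / v x) *: hess v x
  + (\tr (hess v x) / v x - (n%:R - 1) * dot (grad v x) (grad v x) / v x ^+ 2)%:M.
Proof.
have v0 : v x != 0 by rewrite gt_eqF.
apply/matrixP => i j; rewrite mxE.
have CE l a b : christoffel inv_sq_metric l a b = fun y => conf_christoffel (q y) l a b.
  by apply/funext => y; exact: christoffel_inv_sq.
have -> : \sum_l \sum_m (christoffel inv_sq_metric l l m x * christoffel inv_sq_metric m i j x
     - christoffel inv_sq_metric l j m x * christoffel inv_sq_metric m i l x) =
    (n%:R - 2) * (q x i * q x j - (i == j)%:R * (\sum_l q x l * q x l)).
  rewrite -conf_christoffel_quadratic; apply: eq_bigr => l _; apply: eq_bigr => m _.
  by rewrite !christoffel_inv_sq.
have dC l a b c : partial c (christoffel inv_sq_metric l a b) x =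
   conf_christoffel (fun d => partial c (fun y => q y d) x) l a b.
  have sq d (e : R) : smooth (fun y => q y d * e).
    by apply: smoothM; [exact: smooth_q|exact: smooth_cst].
  have dq d (e : R) : partial c (fun y => q y d * e) x = partial c (fun y => q y d) x * e.
    rewrite partialM; [|exact/smooth_diff/smooth_q|exact/smooth_diff/smooth_cst].
    by rewrite partial_cst mulr0 addr0.
  have sB d e (r t : R) : smooth (fun y => q y d * r - q y e * t) by exact: smoothB.
  rewrite CE /conf_christoffel partialB; [|exact/smooth_diff/sB|exact/smooth_diff/sq].
  rewrite partialB; [|exact/smooth_diff/sq|exact/smooth_diff/sq].
  by rewrite !dq.
under eq_bigr do rewrite !dC.
rewrite (_ : \sum_l q x l * q x l = dot (grad v x) (grad v x) / v x ^+ 2); last first.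
  by rewrite /dot mulr_suml; apply: eq_bigr => l _; rewrite !mxE /q; field.
pose p l d := partial l (fun y => q y d) x.
have pE l d : p l d = hess v x d l / v x - q x d * q x l by exact: partial_q.
have pT : \sum_l p l l = \tr (hess v x) / v x - dot (grad v x) (grad v x) / v x ^+ 2.
  rewrite /mxtrace /dot !mulr_suml -sumrB; apply: eq_bigr => l _.
  by rewrite pE [grad v x 0 l]mxE /q; field.
rewrite [X in X + _](_ : _ = (i == j)%:R * (\sum_l p l l) - p j i - p i j + n%:R * p j i);
  last first.
  rewrite sumrB -[n%:R * p j i]opprK -mulNr.
  exact (congr2 (fun a b => a - b) (conf_christoffel_div p i j) (conf_christoffel_tr (p j) i)).
rewrite pT !pE.
have -> : hess v x j i = hess v x i j by rewrite !mxE partialC.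
rewrite [RHS]mxE [X in _ = X + _]mxE [X in _ = _ + X]mxE -[X in _ = _ + X]mulr_natr /q.
by field.
Qed.

End ConformalCurvature.

(** * Both equations in terms of sigma_k of the metric *)

Section ConformalSoliton.
Context (R : realType) (n : nat).
Hypothesis n_ge3 : (3 <= n)%N.
Implicit Types (x : 'rV[R]_n) (i j l m : 'I_n).

(** In Ric - R g / (2 (n - 1)) the Laplacians of v cancel and |Dv|^2 / v^2 is left with the factor -
    (n - 2) / 2, which the division by n - 2 reduces to - 1/2. *)
Lemma mixed_schouten_inv_sq (v : 'rV[R]_n -> R) x :
  smooth v -> (forall y, 0 < v y) ->
  mixed_schouten (inv_sq_metric v) x = conf_schouten v x.
Proof.
move=> sv v_gt0; have v0 : v x != 0 by rewrite gt_eqF.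
have n3 : 3 <= n%:R :> R by rewrite ler_nat.
have n2 : n%:R - 2 != 0 :> R by apply: lt0r_neq0; lra.
have n1 : n%:R - 1 != 0 :> R by apply: lt0r_neq0; lra.
have iE : invmx (inv_sq_metric v x) = (v x ^+ 2)%:M.
  by rewrite /inv_sq_metric invmx_scalar invrK.
have sE : scalar_curv (inv_sq_metric v) x = v x ^+ 2 *
    ((n%:R - 2) / v x * \tr (hess v x) +
     n%:R * (\tr (hess v x) / v x - (n%:R - 1) * dot (grad v x) (grad v x) / v x ^+ 2)).
  rewrite /scalar_curv iE mul_scalar_mx mxtraceZ ricci_inv_sq// mxtraceD mxtraceZ.
  by rewrite mxtrace_scalar; congr (_ * (_ + _)); rewrite mulr_natl.
rewrite /mixed_schouten iE mul_scalar_mx /schouten sE ricci_inv_sq//.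
rewrite /conf_schouten /inv_sq_metric; move: (hess v x) (grad v x) => H G.
move: (v x) (\tr H) (dot G G) v0 => w t D w0; move: (n%:R) n1 n2 => N N1 N2.
apply/matrixP => i j.
have scE (c : R) (A : 'M[R]_n) : (c *: A) i j = c * A i j by rewrite mxE.
have adE (A B : 'M[R]_n) : (A + B) i j = A i j + B i j by rewrite mxE.
have opE (A : 'M[R]_n) : (- A) i j = - A i j by rewrite mxE.
have diE (c : R) : (c%:M : 'M[R]_n) i j = c * (i == j)%:R by rewrite mxE mulr_natr.
rewrite !(scE, adE, opE, diE); move: (H i j) ((i == j)%:R) => h e.
by field; rewrite w0 N1 N2.
Qed.

Lemma hess_metric_inv_sq (v phi : 'rV[R]_n -> R) x i j :
  smooth v -> (forall y, 0 < v y) ->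
  hess_metric (inv_sq_metric v) phi x i j = partial j (partial i phi) x
   - ((i == j)%:R * (\sum_l partial l v x * partial l phi x)
      - partial i v x * partial j phi x - partial j v x * partial i phi x) / v x.
Proof.
move=> sv v_gt0; rewrite mxE; congr (_ - _).
under eq_bigr do rewrite christoffel_inv_sq//.
rewrite conf_christoffel_low !mulrBl; congr (_ - _ - _); last 2 first.
- by rewrite mulrAC.
- by rewrite mulrAC.
rewrite -mulrA; congr (_ * _); rewrite mulr_suml; apply: eq_bigr => l _.
by rewrite mulrAC.
Qed.

Variables (k : nat) (rho : R) (u : 'rV[R]_n -> R).
Hypotheses (k_gt0 : (0 < k)%N) (u_gt0 : forall x, 0 < u x).
Let a := conf_exp R n k.
Let v := conf_pow k u.

Let nk_gt0 : 0 < n%:R + 2 * k%:R :> R.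
Proof. by rewrite ltr_pwDl ?ltr0n ?(ltn_trans _ n_ge3)// mulr_ge0. Qed.

Lemma conf_pow_gt0 x : 0 < v x.
Proof. exact: powR_gt0. Qed.

Lemma conf_powV x : (v x)^-1 = u x `^ a.
Proof. by rewrite /v /conf_pow powRN invrK. Qed.

Lemma conf_metricE : conf_metric k u = inv_sq_metric v.
Proof.
apply/funext => x; rewrite /conf_metric /inv_sq_metric -exprVn conf_powV.
rewrite -powR_mulrn ?powR_ge0// -powRrM; congr ((_ `^ _)%:M).
by rewrite /a /conf_exp; field; rewrite gt_eqF.
Qed.

Hypothesis su : smooth u.

Lemma smooth_conf_pow : smooth v.
Proof. exact: smooth_powR. Qed.

Lemma conf_pow_grad x : dot x (grad v x) / v x = - a * (dot x (grad u x) / u x).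
Proof.
have u0 : u x != 0 by rewrite gt_eqF.
have v0 : v x != 0 by rewrite gt_eqF// conf_pow_gt0.
rewrite /dot !mulr_suml mulr_sumr; apply: eq_bigr => i _.
rewrite [grad v x 0 i]mxE [grad u x 0 i]mxE.
have -> : partial i v x = - a * (u x `^ (- a - 1)) * partial i u x.
  by rewrite /v /conf_pow partial_powR//; exact: smooth_diff.
have -> : u x `^ (- a - 1) = v x / u x.
  rewrite powRD; last by rewrite u0 implybT.
  by rewrite powR_inv1// ltW.
by field; rewrite u0 v0.
Qed.

(** Here x.Dv / v = - a x.Du / u, and 4 k theta / (n + 2 k) = 2 theta a. *)
Lemma bracketE theta x : bracket k rho theta u x / u x =
  rho + 2 * theta * (1 - dot x (grad v x) / v x).
Proof.
have u0 : u x != 0 by rewrite gt_eqF.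
rewrite conf_pow_grad /bracket /a /conf_exp; field.
by rewrite u0 gt_eqF.
Qed.

Lemma sigma_metricE x : sigma_metric k (conf_metric k u) x = sigma k (conf_schouten v x).
Proof.
rewrite /sigma_metric conf_metricE mixed_schouten_inv_sq//.
- exact: smooth_conf_pow.
- exact: conf_pow_gt0.
Qed.

Lemma is_kth_rootZ (c b s : R) : 0 < c ->
  is_kth_root k b s <-> is_kth_root k (c ^+ k * b) (c * s).
Proof.
move=> c0; rewrite /is_kth_root exprMn; split=> -[E s0].
  by rewrite E; split=> // /s0; exact/mulr_ge0/ltW.
split; last by move=> /s0; rewrite pmulr_rge0.
by apply: (mulfI _ E); rewrite expf_neq0// gt_eqF.
Qed.

Hypothesis k_le_n : (k <= n)%N.

(** The equation is multiplied by v: sigma_k is homogeneous of degree k, v times its matrix is the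
    mixed Schouten tensor, and v u^(a - 1) = 1 / u. *)
Lemma soliton_eqE theta x : soliton_eq k rho theta u x <->
  is_kth_root k (sigma_metric k (conf_metric k u) x)
    (rho + 2 * theta * (1 - dot x (grad v x) / v x)).
Proof.
rewrite -bracketE sigma_metricE /soliton_eq -/a -/v.
have v0 := conf_pow_gt0 x; have u0 := u_gt0 x.
apply: (iff_trans (is_kth_rootZ _ _ v0)).
have -> : v x * (u x `^ (a - 1) * bracket k rho theta u x) = bracket k rho theta u x / u x.
  rewrite powRD; last by apply/implyP => _; exact: lt0r_neq0.
  rewrite -conf_powV powR_inv1; last exact: ltW.
  by field; rewrite !gt_eqF.
set M := hess v x - _.
have Ms : M^T = M.
  by rewrite /M linearB /= hess_sym ?tr_scalar_mx//; exact: smooth_conf_pow.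
rewrite -(sigmaZ (v x) Ms k_le_n).
suff -> : sigma k (v x *: M) = sigma k (conf_schouten v x) by [].
congr (sigma k _); rewrite /M scalerBr scale_scalar_mx /conf_schouten -conf_powV sqr_enorm.
congr (_ - _%:M); field; exact: lt0r_neq0.
Qed.

Lemma soliton_div_eqE theta x : soliton_div_eq k rho theta u x <->
  sigma_metric k (conf_metric k u) x =
    (rho + 2 * theta * (1 - dot x (grad v x) / v x)) ^+ k.
Proof.
rewrite -bracketE sigma_metricE /soliton_div_eq -/a -/v.
have v0 := conf_pow_gt0 x; have u0 := u_gt0 x.
have WE : mixed_schouten (conf_metric k u) = conf_schouten v.
  apply/funext => y; rewrite conf_metricE mixed_schouten_inv_sq//.
  - exact: smooth_conf_pow.
  - exact: conf_pow_gt0.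
rewrite WE.
have k1n : (k.-1 < n)%N by rewrite prednK.
have := divergence_newton_grad x smooth_conf_pow k1n; rewrite /= -/v prednK//.
set D := \sum_j _; set Q := \sum_i _; set S := sigma k.-1 _; set G := dot _ _.
move=> DE; rewrite -conf_powV sqr_enorm -/G.
(* The exponent equals a - k, and u^a = v^-1. *)
have -> : u x `^ (k%:R * (2 - n%:R - 2 * k%:R) / (n%:R + 2 * k%:R)) = (v x)^-1 / u x ^+ k.
  have -> : k%:R * (2 - n%:R - 2 * k%:R) / (n%:R + 2 * k%:R) = a - k%:R.
    by rewrite /a /conf_exp; field; rewrite gt_eqF.
  rewrite powRD; last by apply/implyP => _; exact: lt0r_neq0.
  by rewrite powR_invn ?ltW// -conf_powV.
have nkE : (n - k.-1)%:R = n%:R - k%:R + 1 :> R.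
  by rewrite -[X in _ - X%:R](prednK k_gt0) natrB -?natr1; [ring|exact: ltnW].
(* After multiplication by v the gradient terms are opposite to those of [divergence_newton_grad],
   and only k sigma_k is left. *)
have -> : D - n%:R / v x * Q + (v x)^-1 * ((n%:R - k%:R + 1) / 2) * S * G =
    k%:R * (v x)^-1 * sigma k (conf_schouten v x).
  apply: (mulfI (lt0r_neq0 v0)); rewrite mulrDr mulrBr DE nkE.
  by field; exact: lt0r_neq0.
have k0 : k%:R * (v x)^-1 != 0 :> R by rewrite mulf_neq0 ?invr_eq0 ?pnatr_eq0 -?lt0n// gt_eqF.
rewrite expr_div_n; set B := bracket _ _ _ _ _.
have -> : k%:R * ((v x)^-1 / u x ^+ k) * B ^+ k = k%:R * (v x)^-1 * (B ^+ k / u x ^+ k).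
  by rewrite -!mulrA [(u x ^+ k)^-1 * _]mulrC.
by split=> [/(mulfI k0)|->].
Qed.

End ConformalSoliton.

(** * Rotational symmetry *)

Section Orthogonal.
Context (R : realType) (n : nat).
Implicit Types (x y z : 'rV[R]_n) (i j l : 'I_n) (Q : 'M[R]_n) (f : 'rV[R]_n -> R).

Definition orthogonal Q := Q *m Q^T = 1%:M.

Definition rot_invariant f := forall Q, orthogonal Q -> forall x, f (x *m Q) = f x.

Lemma dotE x y : dot x y = (x *m y^T) 0 0.
Proof. by rewrite mxE; apply: eq_bigr => i _; rewrite mxE. Qed.

Lemma dotC x y : dot x y = dot y x.
Proof. by apply: eq_bigr => i _; rewrite mulrC. Qed.

Lemma dotZr c x y : dot x (c *: y) = c * dot x y.
Proof. by rewrite mulr_sumr; apply: eq_bigr => i _; rewrite mxE mulrCA. Qed.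

Lemma dotZl c x y : dot (c *: x) y = c * dot x y.
Proof. by rewrite dotC dotZr dotC. Qed.

Lemma dotBr x y z : dot x (y - z) = dot x y - dot x z.
Proof. by rewrite -sumrB; apply: eq_bigr => i _; rewrite !mxE mulrBr. Qed.

Lemma dotBl x y z : dot (y - z) x = dot y x - dot z x.
Proof. by rewrite dotC dotBr !(dotC x). Qed.

Lemma dot_delta i x : dot x (delta_mx 0 i) = x 0 i.
Proof.
rewrite /dot (bigD1 i)//= big1 ?addr0; first by rewrite mxE !eqxx mulr1.
by move=> j /negPf ji; rewrite mxE ji andbF mulr0.
Qed.

Lemma dot_mulmx Q x y : orthogonal Q -> dot (x *m Q) (y *m Q) = dot x y.
Proof. by move=> oQ; rewrite !dotE trmx_mul mulmxA -(mulmxA x) oQ mulmx1. Qed.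

Lemma dot_eq0 x : (dot x x == 0) = (x == 0).
Proof.
apply/eqP/eqP => [E|->]; last by rewrite /dot big1// => i _; rewrite mxE mul0r.
apply/rowP => i; rewrite [RHS]mxE; apply/eqP; rewrite -sqrf_eq0 expr2.
move/eqP: E; rewrite psumr_eq0; last by move=> j _; rewrite -expr2 sqr_ge0.
by move/allP/(_ i (mem_index_enum i)).
Qed.

Definition householder y : 'M[R]_n := 1%:M - (2 / dot y y) *: (y^T *m y).

Lemma mul_householder x y : x *m householder y = x - (2 * dot x y / dot y y) *: y.
Proof.
rewrite mulmxBr mulmx1 -scalemxAr mulmxA; congr (_ - _).
rewrite [x *m y^T]mx11_scalar -dotE mul_scalar_mx scalerA; congr (_ *: _).
by rewrite mulrAC.
Qed.

Lemma householder_sym y : (householder y)^T = householder y.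
Proof. by rewrite /householder linearB linearZ /= trmx1 trmx_mul trmxK. Qed.

Lemma householder_orthogonal y : y != 0 -> orthogonal (householder y).
Proof.
rewrite -dot_eq0 => y0; rewrite /orthogonal householder_sym /householder.
set S := y^T *m y; set d := dot y y in y0 *.
have SS : S *m S = d *: S.
  by rewrite /S -mulmxA (mulmxA y) [y *m y^T]mx11_scalar -dotE mul_scalar_mx -scalemxAr.
rewrite mulmxBl !mulmxBr !mul1mx mulmx1 -scalemxAl -scalemxAr SS !scalerA.
rewrite (_ : 2 / d * (2 / d) * d = 2 / d + 2 / d); last by field.
by rewrite scalerDl opprB addrK subrK.
Qed.

Lemma householder_fix x y : dot x y = 0 -> x *m householder y = x.
Proof. by move=> xy; rewrite mul_householder xy mulr0 mul0r scale0r subr0. Qed.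

Lemma enorm_mulmx Q x : orthogonal Q -> enorm (x *m Q) = enorm x.
Proof. by move=> oQ; rewrite /enorm dot_mulmx. Qed.

Lemma orthogonalN1 : orthogonal (- 1%:M).
Proof. by rewrite /orthogonal linearN /= trmx1 mulNmx mulmxN opprK mulmx1. Qed.

Lemma orthogonal_tr Q : orthogonal Q -> Q^T *m Q = 1%:M.
Proof. exact: mulmx1C. Qed.

(** The vectors x and |x| e_i have the same norm, so the reflection along their difference exchanges
    them. *)
Lemma rotate_to_axis i x : exists2 Q, orthogonal Q & x *m Q = enorm x *: delta_mx 0 i.
Proof.
pose r := enorm x; pose y := x - r *: delta_mx 0 i.
have [y0|y0] := eqVneq y 0.
  exists 1%:M; first by rewrite /orthogonal trmx1 mulmx1.
  by rewrite mulmx1; apply/eqP; rewrite -subr_eq0; apply/eqP.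
exists (householder y); first exact: householder_orthogonal.
rewrite mul_householder.
have ee : dot (delta_mx 0 i : 'rV[R]_n) (delta_mx 0 i) = 1.
  by rewrite dot_delta mxE !eqxx.
have rr : r * r = dot x x by rewrite -expr2 sqr_enorm.
have E : 2 * dot x y = dot y y.
  rewrite /y !dotBr !dotBl !dotZr !dotZl ee mulr1 rr (dotC (delta_mx 0 i) x); ring.
rewrite E divff ?dot_eq0// scale1r /y opprB addrC.
by rewrite subrK.
Qed.

Lemma radial_rot_invariant f : (0 < n)%N -> radial f <-> rot_invariant f.
Proof.
move=> n0; split=> [[h hE] Q oQ x|fQ]; first by rewrite !hE enorm_mulmx.
pose i0 := Ordinal n0.
exists (fun r => f (r *: delta_mx 0 i0)) => x.
by have [Q oQ <-] := rotate_to_axis i0 x; rewrite fQ.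
Qed.

Section RotInvariant.
Variable f : 'rV[R]_n -> R.
Hypotheses (sf : smooth f) (fQ : rot_invariant f).

Lemma partial_rot Q i x : orthogonal Q ->
  partial i f x = \sum_j Q i j * partial j f (x *m Q).
Proof.
move=> oQ; rewrite -partial_mulmxr; last exact: smooth_diff.
by congr (partial i _ x); apply/funext => y; rewrite fQ.
Qed.

Lemma grad_rot Q x : orthogonal Q -> grad f x = grad f (x *m Q) *m Q^T.
Proof.
move=> oQ; apply/rowP => i; rewrite !mxE (partial_rot i x oQ).
by apply: eq_bigr => j _; rewrite !mxE mulrC.
Qed.

Lemma hess_rot Q x : orthogonal Q -> hess f x = Q *m hess f (x *m Q) *m Q^T.
Proof.
move=> oQ; apply/matrixP => i j; rewrite [LHS]mxE.
have -> : partial i f = fun y => \sum_a Q i a * partial a f (y *m Q).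
  by apply/funext => y; exact: partial_rot.
rewrite (@partial_mulmxr _ _ (fun y => \sum_a Q i a * partial a f y)); last first.
  apply: smooth_diff; apply: smooth_sum => a.
  by apply: smoothM; [exact: smooth_cst|exact: smooth_partial].
rewrite mxE; apply: eq_bigr => b _; rewrite [Q^T _ _]mxE mulrC; congr (_ * _).
rewrite mxE partial_sum; last first.
  move=> a; apply/smooth_diff/smoothM; [exact: smooth_cst|exact: smooth_partial].
apply: eq_bigr => a _; rewrite partialM; last 2 first.
- exact/smooth_diff/smooth_cst.
- exact/smooth_diff/smooth_partial.
by rewrite partial_cst mul0r add0r mxE.
Qed.

Lemma dot_grad_rot Q x : orthogonal Q -> dot x (grad f x) = dot (x *m Q) (grad f (x *m Q)).
Proof.
move=> oQ; rewrite [grad f x](grad_rot x oQ) -(dot_mulmx x _ oQ) -mulmxA.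
by rewrite orthogonal_tr// mulmx1.
Qed.

Lemma grad0 i : partial i f 0 = 0.
Proof.
have := congr1 (fun g : 'rV[R]_n => g 0 i) (grad_rot 0 orthogonalN1).
rewrite mul0mx linearN /= trmx1 mulmxN mulmx1 !mxE => E; lra.
Qed.

(** The gradient is parallel to x: the reflection along y = x_j e_i - x_i e_j fixes x, hence fixes
    the gradient there, which is therefore orthogonal to y. *)
Lemma partial_cross i j x : x 0 j * partial i f x = x 0 i * partial j f x.
Proof.
pose y : 'rV[R]_n := x 0 j *: delta_mx 0 i - x 0 i *: delta_mx 0 j.
have gy (z : 'rV[R]_n) : dot z y = x 0 j * z 0 i - x 0 i * z 0 j.
  by rewrite dotBr !dotZr !dot_delta.
apply/eqP; rewrite -subr_eq0.
have -> : x 0 j * partial i f x - x 0 i * partial j f x = dot (grad f x) y.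
  by rewrite gy !mxE.
have [->|y0] := eqVneq y 0; first by rewrite /dot big1// => l _; rewrite [X in _ * X]mxE mulr0.
have xy : x *m householder y = x by apply: householder_fix; rewrite gy mulrC subrr.
have := grad_rot x (householder_orthogonal y0).
rewrite xy householder_sym mul_householder => /eqP.
rewrite eq_sym subr_eq -subr_eq0 opprD addNKr oppr_eq0 scaler_eq0 (negPf y0) orbF.
by rewrite !mulf_eq0 invr_eq0 dot_eq0 (negPf y0) orbF pnatr_eq0.
Qed.

Lemma partial_cross_diff i j l x :
  (l == j)%:R * partial i f x + x 0 j * partial l (partial i f) x =
  (l == i)%:R * partial j f x + x 0 i * partial l (partial j f) x.
Proof.
have P a b : partial l (fun y => y 0 b * partial a f y) x =
    (l == b)%:R * partial a f x + x 0 b * partial l (partial a f) x.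
  rewrite partialM; last 2 first.
  - exact/smooth_diff/smooth_coord.
  - exact/smooth_diff/smooth_partial.
  by rewrite partial_coord eq_sym.
rewrite -!P; congr (partial l _ x); apply/funext => y; exact: partial_cross.
Qed.

Lemma conf_schouten_rot Q x : orthogonal Q ->
  conf_schouten f x = Q *m conf_schouten f (x *m Q) *m Q^T.
Proof.
move=> oQ; rewrite /conf_schouten mulmxBr mulmxBl -scalemxAr -scalemxAl.
rewrite (fQ oQ) -hess_rot//; congr (_ - _).
rewrite mul_mx_scalar -scalemxAl oQ scale_scalar_mx mulr1 (grad_rot x oQ).
have oT : orthogonal Q^T by rewrite /orthogonal trmxK orthogonal_tr.
by rewrite dot_mulmx.
Qed.

Lemma sigma_conf_schouten_rot Q k x : orthogonal Q ->
  sigma k (conf_schouten f (x *m Q)) = sigma k (conf_schouten f x).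
Proof.
move=> oQ; apply: sigma_char_poly.
by rewrite (conf_schouten_rot x oQ) char_poly_conj.
Qed.

End RotInvariant.

End Orthogonal.

(** * Potentials of radial vector fields *)

Section Potential.
Context (R : realType) (n : nat).
Implicit Types (x : 'rV[R]_n) (i j : 'I_n).

Lemma continuous_antiderivative (h : R -> R) (a : R) : continuous h ->
  exists F : R -> R, forall x : R, a < x -> is_derive x 1 F (h x).
Proof.
move=> ch.
pose F (x : R) := (\int[@lebesgue_measure R]_(t in [set` `[a, x]%R]) h t)%R.
exists F => x ax.
have int : (@lebesgue_measure R).-integrable [set` `[a, x + 1]%R] (EFin \o h).
  apply: continuous_compact_integrable; first exact: segment_compact.
  exact: continuous_subspaceT.
have x1 : x < x + 1 by rewrite ltrDl.
have [dF FE] := continuous_FTC1_closed x1 int ax (ch x).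
by split; [exact: dF|rewrite -derive1E].
Qed.

Lemma smooth_dot : smooth (fun x : 'rV[R]_n => dot x x).
Proof. by apply: smooth_sum => i; apply: smoothM; exact: smooth_coord. Qed.

Lemma partial_dot i x : partial i (fun y => dot y y) x = 2 * x 0 i.
Proof.
rewrite partial_sum; last by move=> j; apply/smooth_diff/smoothM; exact: smooth_coord.
rewrite -[RHS](sum_delta (fun j => 2 * x 0 j)); apply: eq_bigr => j _.
rewrite partialM; try exact/smooth_diff/smooth_coord.
by rewrite partial_coord; ring.
Qed.

(* Parametrizing by |x|^2 rather than |x| avoids the singularity of the norm
   at the origin; the junk value sqrt q = 0 for q < 0 makes the integrand
   continuous on the whole line. *)
Lemma radial_potential (G : 'rV[R]_n -> R) : (0 < n)%N -> smooth G -> rot_invariant G ->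
  exists2 phi, smooth phi & forall i x, partial i phi x = x 0 i * G x.
Proof.
move=> n0 sG GQ; pose e : 'rV[R]_n := delta_mx 0 (Ordinal n0).
pose h q := 2^-1 * G (Num.sqrt q *: e).
have ch : continuous h.
  move=> q; apply: cvgM; first exact: cvg_cst.
  apply: (@continuous_comp _ _ _ (fun q : R => Num.sqrt q *: e) G).
    apply: (@continuous_comp _ _ _ (@Num.sqrt R) (fun r => r *: e)).
      exact: sqrt_continuous.
    exact: scalel_continuous.
  exact/differentiable_continuous/smooth_diff.
(* A negative base point makes the antiderivative differentiable at |x|^2 = 0 too, hence at the
   origin. *)
have [F dF] := continuous_antiderivative (-1) ch.
pose phi x := F (dot x x).
have dot1 x : -1 < dot x x by apply: lt_le_trans (dot_ge0 x); rewrite ltrN10.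
have dphi x : differentiable phi x.
  apply: differentiable_comp1; last exact/smooth_diff/smooth_dot.
  by have [] := dF _ (dot1 x).
have pphi i x : partial i phi x = x 0 i * G x.
  have [dFx FE] := dF _ (dot1 x).
  rewrite /phi partial_comp1//; last exact/smooth_diff/smooth_dot.
  rewrite FE partial_dot /h -/(enorm x).
  have [Q oQ <-] := rotate_to_axis (Ordinal n0) x; rewrite GQ//.
  by field.
exists phi => //; apply: smooth_partials => // i.
have -> : partial i phi = fun x => x 0 i * G x by apply/funext => x; exact: pphi.
by apply: smoothM => //; exact: smooth_coord.
Qed.

End Potential.

(** * Positivity of the soliton speed *)

Section RealODE.
Context (R : realType).
Implicit Types (f g : R -> R) (a b t x : R).

Lemma is_derive1D f g t (a b : R) : is_derive t 1 f a -> is_derive t 1 g b ->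
  is_derive t 1 (fun s => f s + g s) (a + b).
Proof. by move=> fa gb; exact: is_deriveD. Qed.

Lemma is_derive1B f g t (a b : R) : is_derive t 1 f a -> is_derive t 1 g b ->
  is_derive t 1 (fun s => f s - g s) (a - b).
Proof. by move=> fa gb; exact: is_deriveB. Qed.

Lemma is_derive1M f g t (a b : R) : is_derive t 1 f a -> is_derive t 1 g b ->
  is_derive t 1 (fun s => f s * g s) (a * g t + f t * b).
Proof.
move=> fa gb; have [dM ME] := is_deriveM fa gb.
split; first exact: dM.
by rewrite -[LHS]/('D_1 (f * g) t) ME /GRing.scale /= addrC [g t * a]mulrC.
Qed.

Lemma is_derive1_cst (c : R) t : is_derive t 1 (fun=> c) (0 : R).
Proof. exact: is_derive_cst. Qed.

Lemma is_derive1_id t : is_derive t 1 (fun s : R => s) (1 : R).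
Proof. exact: is_derive_id. Qed.

Lemma is_derive1V f t (a : R) : f t != 0 -> is_derive t 1 f a ->
  is_derive t 1 (fun s => (f s)^-1) (- a / f t ^+ 2).
Proof.
move=> f0 [df fa]; have [dV VE] := (@derivableV _ _ f t 1 f0 df, @deriveV _ _ f t 1 f0 df).
split; first exact: dV.
by rewrite -[LHS]/('D_1 (fun s => (f s)^-1) t) VE fa /GRing.scale /= !mulNr mulrC.
Qed.

Lemma is_derive1_expR f t (a : R) : is_derive t 1 f a ->
  is_derive t 1 (fun s => expR (f s)) (expR (f t) * a).
Proof. by move=> fa; exact: (@is_derive1_comp _ expR f). Qed.

Lemma is_derive_continuous f df : (forall t, is_derive t 1 f (df t)) -> continuous f.
Proof.
move=> dft t; apply: differentiable_continuous; apply/derivable1_diffP.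
by have [] := dft t.
Qed.

Lemma derive_neg_local f d x : is_derive x 1 f d -> d < 0 ->
  exists2 e : R, 0 < e & forall h : R, 0 < h < e -> f (x + h) < f x < f (x - h).
Proof.
move=> [df fE] d0.
have : ((fun h : R => h^-1 *: (f (h *: 1 + x) - f x)) @ (0 : R)^' --> d)%classic.
  by rewrite -fE; exact: df.
move=> /cvgrPdist_lt/(_ (- d)); rewrite oppr_gt0 => /(_ d0).
case=> e /= e0 He; exists e => // h /andP[h0 he].
have P r : `|r| < e -> r != 0 -> r^-1 * (f (r + x) - f x) < 0.
  move=> re r0; have := He r; rewrite /ball_ /= sub0r normrN => /(_ re r0).
  rewrite [r *: 1]mulr1 => /ltr_normlP[H _]; move: H; rewrite opprB.
  by rewrite ltrBlDr addNr.
apply/andP; split.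
- have := P h; rewrite gtr0_norm// => /(_ he); rewrite gt_eqF// => /(_ isT).
  by rewrite pmulr_rlt0 ?invr_gt0// subr_lt0 addrC.
- have := P (- h); rewrite normrN gtr0_norm// => /(_ he).
  rewrite oppr_eq0 gt_eqF// => /(_ isT).
  by rewrite nmulr_rlt0 ?invr_lt0 ?oppr_lt0// subr_gt0 addrC.
Qed.

Lemma first_zero f a b : continuous f -> a < b -> 0 < f a -> f b <= 0 ->
  exists t : R, [/\ a < t, t <= b, f t = 0 & forall r : R, a <= r < t -> 0 < f r].
Proof.
move=> cf ab fa fb.
pose A := [set t | a <= t <= b /\ f t <= 0]%classic.
have Ab : A b by split; rewrite // lexx ltW.
have hA : has_inf A.
  by split; [exists b | exists a => t [/andP[]]].
pose t0 := inf A.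
have t0a : a <= t0 by apply: lb_le_inf; [exists b|move=> t [/andP[]]].
have t0b : t0 <= b by apply: ge_inf => //; case: hA.
have pos r : a <= r < t0 -> 0 < f r.
  move=> /andP[ar rt]; rewrite ltNge; apply/negP => fr.
  have Ar : A r by split=> //; rewrite ar (ltW (lt_le_trans rt t0b)).
  have : t0 <= r by apply: ge_inf => //; case: hA.
  by rewrite leNgt rt.
have ft0 : f t0 <= 0.
  rewrite leNgt; apply/negP => f0.
  have /cvgrPdist_lt/(_ _ f0) := cf t0 => -[e /= e0 He].
  have [r Ar rt] := inf_adherent e0 hA; rewrite -/t0 in rt.
  have tr : t0 <= r by apply: ge_inf => //; case: hA.
  have := He r; rewrite /ball_ /= distrC ger0_norm ?subr_ge0// ltrBlDl => /(_ rt).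
  case: Ar => _ fr; move=> /ltr_normlP[_ H].
  by move: H; rewrite ltrBlDr; move=> H; lra.
have t0a' : a < t0.
  by rewrite lt_neqAle t0a andbT; apply: contraTneq ft0 => <-; rewrite -ltNge.
exists t0; split=> //; apply/eqP; rewrite eq_le ft0 /= leNgt; apply/negP => f0.
have nf0 : 0 < - f t0 by rewrite oppr_gt0.
have /cvgrPdist_lt/(_ _ nf0) := cf t0 => -[e /= e0 He].
pose r := Num.max a (t0 - e / 2).
have rt : r < t0 by rewrite /r gt_max t0a' ltrBlDr ltrDl divr_gt0.
have ar : a <= r by rewrite /r le_max lexx.
have := He r; rewrite /ball_ /= gtr0_norm ?subr_gt0//.
have -> : t0 - r < e.
  have : t0 - e / 2 <= r by rewrite /r le_max lexx orbT.
  by move=> H; lra.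
move=> /(_ isT) /ltr_normlP[H _]; have : 0 < f r by apply: pos; rewrite ar rt.
by move: H; rewrite opprB; move=> H1 H2; lra.
Qed.

Lemma derive_ge0_le f df a b : (forall t, is_derive t 1 f (df t)) -> a <= b ->
  (forall t, a < t < b -> 0 <= df t) -> f a <= f b.
Proof.
move=> dft; rewrite le_eqVlt => /predU1P[->//|ab] H.
have cf : {within `[a, b], continuous f}%classic.
  exact/continuous_subspaceT/(is_derive_continuous dft).
have [c /[!in_itv]/= cab /eqP] := MVT ab (fun t _ => dft t) cf.
by rewrite subr_eq => /eqP ->; rewrite lerDr mulr_ge0 ?subr_ge0 ?H// ltW.
Qed.

(** Gronwall's lemma near b only, since beta may be unbounded elsewhere: close to b it exceeds - B
    with B = |beta b| + 1, so f e^(B t) does not decrease and stays positive up to b. *)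
Lemma linear_ode_pos f df (beta : R -> R) a b : (forall t, is_derive t 1 f (df t)) ->
  {for b, continuous beta} -> a < b ->
  (forall t, a < t < b -> 0 < f t) ->
  (forall t, a < t < b -> df t = f t * beta t) -> f b != 0.
Proof.
move=> dft cb ab fpos fE.
have /cvgrPdist_lt/(_ _ ltr01) := cb => -[e /= e0 He].
pose r := Num.max ((a + b) / 2) (b - e / 2).
have rb : r < b by rewrite /r gt_max; apply/andP; split; lra.
have ar : a < r by rewrite /r lt_max; apply/orP; left; lra.
have re : b - e < r by rewrite /r lt_max; apply/orP; right; lra.
pose B := `|beta b| + 1.
pose g t := f t * expR (B * t).
pose dg t := (df t + B * f t) * expR (B * t).
have dgt t : is_derive t 1 g (dg t).
  have dE := is_derive1_expR (is_derive1M (is_derive1_cst B t) (is_derive1_id t)).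
  by apply: is_derive_eq (is_derive1M (dft t) dE) _; rewrite /dg; ring.
have : g r <= g b.
  apply: (derive_ge0_le dgt (ltW rb)) => t /andP[rt tb].
  rewrite /dg mulr_ge0 ?expR_ge0// fE ?(lt_trans ar rt)// mulrC -mulrDl.
  rewrite mulr_ge0//; last by rewrite ltW// fpos// (lt_trans ar rt).
  have := He t; rewrite /ball_ /= gtr0_norm ?subr_gt0//.
  have -> : b - t < e by lra.
  move=> /(_ isT) /ltr_normlP[_ H]; rewrite /B.
  have := ler_norm (- beta b); rewrite normrN; lra.
have : 0 < g r by rewrite mulr_gt0 ?expR_gt0// fpos// ar rb.
move=> H1 H2; apply/eqP => fb0; move: (lt_le_trans H1 H2).
by rewrite /g fb0 mul0r ltxx.
Qed.

End RealODE.

(** * The ordinary differential equation along a ray *)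

Section SolitonODE.
Context (R : realType).
Implicit Types (f g : R -> R) (t : R).

Lemma half_lt (x : R) : 0 < x -> x / 2 < x.
Proof. by move=> x0; lra. Qed.

Lemma continuous_at_mul f g t : {for t, continuous f} -> {for t, continuous g} ->
  {for t, continuous (fun s => f s * g s)}.
Proof. by move=> cf cg; exact: cvgM. Qed.

Lemma continuous_at_sub f g t : {for t, continuous f} -> {for t, continuous g} ->
  {for t, continuous (fun s => f s - g s)}.
Proof. by move=> cf cg; exact: cvgB. Qed.

Lemma continuous_at_inv f t : f t != 0 -> {for t, continuous f} ->
  {for t, continuous (fun s => (f s)^-1)}.
Proof. by move=> f0 cf; exact: cvgV. Qed.

Lemma continuous_at_cst (c : R) t : {for t, continuous (fun=> c)}.
Proof. exact: cvg_cst. Qed.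

Lemma continuous_at_exp f (m : nat) t : {for t, continuous f} ->
  {for t, continuous (fun s => f s ^+ m)}.
Proof.
move=> cf; case: m => [|m]; first exact: continuous_at_cst.
elim: m => [|m IH]; [exact: cf | exact: (continuous_at_mul cf IH)].
Qed.

(* Here v is the conformal factor along a ray, p the logarithmic derivative of
   t / v t, and k = K + 1. In these terms the eigenvalues of the Schouten tensor
   are v^2 q / t^2 (tangential) and - v^2 (t p' + q) / t^2 (radial), and the
   equation sigma_k = s^k becomes the hypothesis ode, with
   c = 'C(n - 1, k - 1) and b = 'C(n - 1, k) - c. *)
Variables (K : nat) (b c rho theta : R) (v v' p p' : R -> R).
Hypotheses (dv : forall t, is_derive t 1 v (v' t)) (v_gt0 : forall t, 0 < v t).
Hypotheses (pE : forall t, p t = 1 - t * v' t / v t)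
           (dp : forall t, is_derive t 1 p (p' t)).
Let q t := (1 - p t ^+ 2) / 2.
Let s t := rho + 2 * theta * p t.
Hypothesis c_gt0 : 0 < c.
(** For k = 1 one has b = n - 2, so n >= 3 enters here. *)
Hypothesis K0_bc : K = 0%N -> 1 <= b /\ c = 1.
Hypothesis ode : forall t, 0 < t ->
  v t ^+ (2 * K.+1) * (q t ^+ K * (b * q t - c * (t * p' t))) =
  t ^+ (2 * K.+1) * s t ^+ K.+1.
Hypothesis s_ge0 : (0 < K)%N -> forall t, 0 < t -> 0 <= s t.
Hypothesis s0_gt0 : 0 < 2 * theta + rho.

Let v0 t : v t != 0. Proof. exact: lt0r_neq0. Qed.

Let ds t : is_derive t 1 s (2 * theta * p' t).
Proof.
have H := is_derive1D (is_derive1_cst rho t) (is_derive1M (is_derive1_cst (2 * theta) t) (dp t)).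
by apply: is_derive_eq H _; ring.
Qed.

Let cp t : {for t, continuous p}. Proof. exact: (is_derive_continuous dp). Qed.

Let cv t : {for t, continuous v}. Proof. exact: (is_derive_continuous dv). Qed.

Let cs t : {for t, continuous s}. Proof. exact: (is_derive_continuous ds). Qed.

Let cq t : {for t, continuous q}.
Proof.
apply: continuous_at_mul; last exact: continuous_at_cst.
apply: continuous_at_sub; first exact: continuous_at_cst.
exact: continuous_at_exp.
Qed.

Section FirstZero.
Variable t0 : R.
Hypotheses (t0_gt0 : 0 < t0) (st0 : s t0 = 0) (s_gt0 : forall r : R, 0 <= r < t0 -> 0 < s r).

Let s_pos (r : R) : 0 < r < t0 -> 0 < s r.
Proof. by move=> /andP[r0 rt]; apply: s_gt0; rewrite ltW. Qed.

Let qK_neq0 (r : R) : 0 < r < t0 -> q r ^+ K != 0.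
Proof.
move=> rt; have /andP[r0 _] := rt; apply/eqP => q0.
have := ode r0; rewrite q0 mul0r mulr0 => /esym/eqP.
by rewrite mulf_eq0 !expf_eq0 /= (gt_eqF r0) (gt_eqF (s_pos rt)) /= ?andbF.
Qed.

Let theta_p : 0 < 2 * theta * (1 - p t0).
Proof. by move: st0 s0_gt0; rewrite /s => H1 H2; lra. Qed.

(** At p = -1 the factor q vanishes and the equation degenerates. But then rho = 2 theta, so s = 2
    theta (1 + p) and q = y (1 + p) with y(t0) = 1; cancelling (1 + p)^K leaves a linear equation
    for 1 + p, to which Gronwall's lemma applies. *)
Lemma first_zero_not_N1 : p t0 <> -1.
Proof.
move=> p1; pose y t := (1 - p t) / 2.
have rhoE : rho = 2 * theta by move: st0; rewrite /s p1; lra.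
have sE t : s t = 2 * theta * (1 + p t) by rewrite /s rhoE; ring.
have qE t : q t = y t * (1 + p t) by rewrite /q /y; field.
have theta0 : 0 < theta by move: theta_p; rewrite p1; lra.
pose beta t := (b * y t - (t ^+ (2 * K.+1) * (2 * theta) ^+ K.+1) / (v t ^+ (2 * K.+1) * y t ^+ K))
   * (c * t)^-1.
have y1 : y t0 = 1 by rewrite /y p1; field.
have cy t : {for t, continuous y}.
  apply: continuous_at_mul; last exact: continuous_at_cst.
  by apply: continuous_at_sub; [exact: continuous_at_cst|exact: cp].
have cid t : {for t, continuous (fun r : R => r)} by exact: cvg_id.
have cb : {for t0, continuous beta}.
  apply: continuous_at_mul; last first.
    apply: continuous_at_inv; first by rewrite mulf_neq0 ?gt_eqF.
    by apply: continuous_at_mul => //; exact: continuous_at_cst.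
  apply: continuous_at_sub; first by apply: continuous_at_mul => //; exact: continuous_at_cst.
  apply: continuous_at_mul.
    apply: continuous_at_mul; last exact: continuous_at_cst.
    exact: continuous_at_exp.
  apply: continuous_at_inv; first by rewrite y1 expr1n mulr1 expf_neq0.
  by apply: continuous_at_mul; exact: continuous_at_exp.
have dz t : is_derive t 1 (fun r => 1 + p r) (p' t).
  by apply: is_derive_eq (is_derive1D (is_derive1_cst 1 t) (dp t)) _; rewrite add0r.
have zpos t : 0 < t < t0 -> 0 < 1 + p t.
  by move=> /s_pos; rewrite sE pmulr_rgt0// mulr_gt0.
suff zE t : 0 < t < t0 -> p' t = (1 + p t) * beta t.
  by have := linear_ode_pos dz cb t0_gt0 zpos zE; rewrite p1 subrr eqxx.
move=> tt; have /andP[t_gt0 _] := tt.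
have z0 : 1 + p t != 0 by rewrite gt_eqF// zpos.
have yK : y t ^+ K != 0.
  by have := qK_neq0 tt; rewrite qE exprMn mulf_eq0 negb_or => /andP[].
have t_neq0 : t != 0 by rewrite gt_eqF.
have c_neq0 : c != 0 by rewrite gt_eqF.
have vK : v t ^+ (2 * K.+1) != 0 by rewrite expf_neq0.
have := ode t_gt0; rewrite qE sE [(y t * _) ^+ K]exprMn [(2 * theta * _) ^+ _]exprMn [(1 + p t) ^+ K.+1]exprSr.
rewrite /beta; move: (v t ^+ _) (t ^+ _) (y t ^+ K) ((2 * theta) ^+ _) vK yK.
have zK : (1 + p t) ^+ K != 0 by rewrite expf_neq0.
move: ((1 + p t) ^+ K) zK => zK zK0 V T Y S V0 Y0 E.
have {}E : V * Y * (b * y t * (1 + p t) - c * t * p' t) = T * S * (1 + p t).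
  apply: (mulfI zK0).
  transitivity (V * (Y * zK * (b * (y t * (1 + p t)) - c * (t * p' t)))); first by ring.
  by rewrite E; ring.
have -> : p' t = (b * y t * (1 + p t) - T * S * (1 + p t) / (V * Y)) / (c * t).
  by rewrite -E; field; rewrite V0 Y0 c_neq0 t_neq0.
by field; rewrite V0 Y0 c_neq0 t_neq0.
Qed.

Lemma first_zero_derive_le0 : 2 * theta * p' t0 <= 0.
Proof.
rewrite leNgt; apply/negP => d0.
have dN : is_derive t0 1 (fun t => 0 - s t) (- (2 * theta * p' t0)).
  by apply: is_derive_eq (is_derive1B (is_derive1_cst 0 t0) (ds t0)) _; rewrite sub0r.
have [|e e0 He] := derive_neg_local dN; first by rewrite oppr_lt0.
pose h := Num.min (e / 2) (t0 / 2).
have h0 : 0 < h by rewrite lt_min !divr_gt0.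
have he : h < e by rewrite /h gt_min; apply/orP; left; exact: half_lt.
have ht : h < t0 by rewrite /h gt_min; apply/orP; right; exact: half_lt.
have := He h; rewrite h0 he st0 subr0 sub0r => /(_ isT) /andP[_ H].
have : 0 < s (t0 - h) by apply: s_pos; rewrite subr_gt0 ht ltrBlDr ltrDl.
by move: H; rewrite sub0r oppr_gt0 => H /(lt_trans H); rewrite ltxx.
Qed.

(** The zero is a minimum of s, so p'(t0) = 0, and the equation at t0 forces b = 0, that is n = 2 k.
    In that case it is linear in s before t0, and Gronwall's lemma excludes the zero. *)
Lemma first_zero_absurd_gt1 : (0 < K)%N -> False.
Proof.
move=> K0.
have p1 : p t0 != -1 by apply/eqP; exact: first_zero_not_N1.
have p2 : 1 - p t0 != 0.
  by apply: contraTneq theta_p => ->; rewrite mulr0 ltxx.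
have q0 : q t0 != 0.
  rewrite /q mulf_eq0 invr_eq0 pnatr_eq0 orbF.
  rewrite (_ : 1 - p t0 ^+ 2 = (1 - p t0) * (1 + p t0)); last by ring.
  by rewrite mulf_eq0 (negPf p2) /= addrC addr_eq0.
have th0 : theta != 0.
  by apply: contraTneq theta_p => ->; rewrite mulr0 mul0r ltxx.
have dle := first_zero_derive_le0.
have dge : 0 <= 2 * theta * p' t0.
  rewrite leNgt; apply/negP => d0.
  have [e e0 He] := derive_neg_local (ds t0) d0.
  have h0 : 0 < e / 2 by rewrite divr_gt0.
  have := He (e / 2); rewrite h0 half_lt// st0 => /(_ isT) /andP[+ _].
  by rewrite ltNge s_ge0// addr_gt0.
have p'0 : p' t0 = 0.
  have /eqP : 2 * theta * p' t0 = 0 by apply/eqP; rewrite eq_le dle dge.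
  by rewrite !mulf_eq0 (negPf th0) pnatr_eq0 /= => /eqP.
have b0 : b = 0.
  have nz : v t0 ^+ (2 * K.+1) * (q t0 ^+ K * q t0) != 0.
    by rewrite (mulf_neq0 (expf_neq0 _ (v0 t0)) (mulf_neq0 (expf_neq0 _ q0) q0)).
  apply: (mulfI nz); rewrite mulr0 -[RHS](mulr0 (t0 ^+ (2 * K.+1))).
  by rewrite -[X in _ = _ * X](expr0n _ K.+1) -st0 -ode// p'0; ring.
pose beta t := - (2 * theta) * (t ^+ (2 * K.+1) * s t ^+ K)
   * (c * t * (v t ^+ (2 * K.+1) * q t ^+ K))^-1.
have cid t : {for t, continuous (fun r : R => r)} by exact: cvg_id.
have cb : {for t0, continuous beta}.
  apply: continuous_at_mul.
    apply: continuous_at_mul; first exact: continuous_at_cst.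
    by apply: continuous_at_mul; exact: continuous_at_exp.
  apply: continuous_at_inv.
    apply: mulf_neq0; first by rewrite mulf_neq0// gt_eqF.
    exact: (mulf_neq0 (expf_neq0 _ (v0 t0)) (expf_neq0 _ q0)).
  apply: continuous_at_mul; last by apply: continuous_at_mul; exact: continuous_at_exp.
  by apply: continuous_at_mul => //; exact: continuous_at_cst.
suff sE t : 0 < t < t0 -> 2 * theta * p' t = s t * beta t.
  by have := linear_ode_pos ds cb t0_gt0 s_pos sE; rewrite st0 eqxx.
move=> tt; have /andP[t_gt0 _] := tt.
have qK := qK_neq0 tt.
have t_neq0 : t != 0 by rewrite gt_eqF.
have c_neq0 : c != 0 by rewrite gt_eqF.
have vK : v t ^+ (2 * K.+1) != 0 by rewrite expf_neq0.
have := ode t_gt0; rewrite b0 mul0r sub0r [s t ^+ K.+1]exprS /beta.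
move: (v t ^+ _) (t ^+ _) (q t ^+ K) (s t ^+ K) vK qK => V T Q S V0 Q0 E.
have -> : 2 * theta * p' t = - (2 * theta) * (V * (Q * - (c * (t * p' t)))) / (c * t * (V * Q)).
  by field; rewrite V0 Q0 c_neq0 t_neq0.
by rewrite E; field; rewrite V0 Q0 c_neq0 t_neq0.
Qed.

Lemma first_zero_absurd_1 : K = 0%N -> False.
Proof.
move=> K0; have [b_ge1 c1] := K0_bc K0.
have ode1 t : 0 < t -> t * p' t = b * q t - (t / v t) ^+ 2 * s t.
  move=> t_gt0; have := ode t_gt0; rewrite K0 c1 muln1 !expr1 expr0 !mul1r => E.
  have v2 : v t ^+ 2 != 0 by rewrite expf_neq0.
  apply/eqP; rewrite eq_sym subr_eq addrC -subr_eq; apply/eqP; apply: (mulfI v2).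
  by rewrite E; field.
(* If p(t0) > -1, then t p' = b q and theta (1 - p) > 0 make s increase at its first zero. What is
   left is rho > 2 theta > 0, with m = rho / (2 theta). *)
have m1 : p t0 < -1.
  rewrite lt_neqAle; apply/andP; split; first by apply/eqP; exact: first_zero_not_N1.
  rewrite leNgt; apply/negP => pN1; have dle := first_zero_derive_le0.
  have := ode1 _ t0_gt0; rewrite st0 mulr0 subr0 => E.
  have : 0 < 2 * theta * (t0 * p' t0).
    rewrite E (_ : 2 * theta * (b * q t0) = b / 2 * ((2 * theta * (1 - p t0)) * (1 + p t0))).
      by apply: mulr_gt0; [lra|apply: mulr_gt0 => //; lra].
    by rewrite /q; field.
  rewrite (_ : 2 * theta * (t0 * p' t0) = t0 * (2 * theta * p' t0)); last by ring.
  by rewrite pmulr_rgt0// ltNge dle.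
have theta_gt0 : 0 < theta.
  have : 0 < 1 - p t0 by lra.
  by move=> H; move: theta_p; rewrite pmulr_lgt0// pmulr_rgt0.
pose m := - p t0; have m_gt1 : 1 < m by rewrite /m; lra.
have sE t : s t = 2 * theta * (p t + m).
  by rewrite /m mulrDr mulrN; move: st0; rewrite /s => H; lra.
have p'_lt0 t : 0 < t -> p t = - m -> p' t < 0.
  move=> t_gt0 pt; have := ode1 _ t_gt0; rewrite sE pt addNr !mulr0 subr0 => E.
  rewrite -(pmulr_rlt0 _ t_gt0) E pmulr_rlt0; last lra.
  rewrite /q pt sqrrN pmulr_llt0 ?invr_gt0// subr_lt0 expr_gt1//; lra.
(* The level -m is crossed only downwards: there s = 0 and q < 0, hence p' < 0. *)
have pm t : t0 < t -> p t < - m.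
  move=> tt; rewrite ltNge; apply/negP => pt.
  have p0m : p t0 = - m by rewrite /m opprK.
  have [e e0 He] := derive_neg_local (dp t0) (p'_lt0 _ t0_gt0 p0m).
  pose h := Num.min (e / 2) ((t - t0) / 2).
  have h0 : 0 < h by rewrite lt_min !divr_gt0// subr_gt0.
  have he : h < e by rewrite /h gt_min; apply/orP; left; exact: half_lt.
  have ht : h < t - t0 by rewrite /h gt_min half_lt ?orbT// subr_gt0.
  have := He h; rewrite h0 he p0m => /(_ isT) /andP[ph _].
  have cf : continuous (fun r => - m - p r).
    have cr r : {for r, continuous (fun z => - m - p z)}.
      by apply: continuous_at_sub; [exact: continuous_at_cst|exact: cp].
    exact: cr.
  have [|||r [hr rt pr fpos]] := first_zero cf (a := t0 + h) (b := t).
  - by rewrite -ltrBrDl.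
  - by rewrite subr_gt0.
  - by rewrite subr_le0.
  have r_gt0 : 0 < r by apply: lt_trans hr; rewrite addr_gt0.
  have pr' : p r = - m by move/eqP: pr; rewrite subr_eq0 => /eqP.
  have [e' e'0 He'] := derive_neg_local (dp r) (p'_lt0 _ r_gt0 pr').
  pose h' := Num.min (e' / 2) (r - (t0 + h)).
  have h'0 : 0 < h' by rewrite lt_min divr_gt0//= subr_gt0.
  have he' : h' < e' by rewrite /h' gt_min half_lt.
  have ht' : h' <= r - (t0 + h) by rewrite /h' ge_min lexx orbT.
  have := He' h'; rewrite h'0 he' pr' => /(_ isT) /andP[_].
  have := fpos (r - h'); rewrite lerBrDr -lerBrDl ht' ltrBlDr ltrDl h'0 => /(_ isT).
  by rewrite subr_gt0 => H1 /(lt_trans H1); rewrite ltxx.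
(* g = t^2 / v decreases while p < -1, so the coefficient (t / v)^2 = (g / t)^2 of s is at most G^2
   / t^2. *)
pose g t := t * (t / v t).
have dg t : is_derive t 1 g (t / v t * (1 + p t)).
  have dV := is_derive1V (v0 t) (dv t); have di := is_derive1_id t.
  apply: is_derive_eq (is_derive1M di (is_derive1M di dV)) _.
  by rewrite pE; field.
pose G := g t0.
have gG t : t0 <= t -> g t <= G.
  move=> tt; rewrite -lerN2.
  have dNg (r : R) : is_derive r 1 (fun r => 0 - g r) (0 - r / v r * (1 + p r)).
    exact: is_derive1B (is_derive1_cst 0 r) (dg r).
  have := derive_ge0_le dNg tt; rewrite !sub0r; apply => r /andP[tr _].
  rewrite sub0r -mulrN mulr_ge0//; last by have := pm _ tr; lra.
  by rewrite divr_ge0// ltW// (lt_trans t0_gt0).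
(* From p^2 >= m^2 follows (1 - p^2) / 2 <= - 2 kappa p^2. *)
pose kappa : R := (1 - (m ^+ 2)^-1) / 4.
have m_gt0 : 0 < m by lra.
have m0 : m != 0 by rewrite gt_eqF.
have kappa_gt0 : 0 < kappa.
  by rewrite divr_gt0// subr_gt0 invf_lt1 ?expr_gt1 ?exprn_gt0//; lra.
have G_gt0 : 0 < G by rewrite /G /g !mulr_gt0// invr_gt0.
have kE : 4 * kappa = 1 - (m ^+ 2)^-1 by rewrite /kappa; field.
clearbody kappa.
have [T [Tt0 T1 TG]] : exists T : R, [/\ t0 < T, 1 <= T & 2 * theta * G ^+ 2 / kappa <= T].
  exists (t0 + 1 + 2 * theta * G ^+ 2 / kappa).
  have : 0 < 2 * theta * G ^+ 2 / kappa.
    by rewrite divr_gt0// mulr_gt0 ?exprn_gt0// mulr_gt0.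
  have H (C : R) : 0 < C -> [/\ t0 < t0 + 1 + C, 1 <= t0 + 1 + C & C <= t0 + 1 + C].
    by have := t0_gt0 => t0' C0; split; lra.
  exact: H.
(* Half of the bound - 2 kappa p^2 for b q absorbs the term in s, which is at most kappa p^2 once t
   >= T. *)
have p_growth t : T <= t -> t * p' t <= - kappa * p t ^+ 2.
  move=> Tt; have t_gt0 : 0 < t by exact: lt_trans t0_gt0 (lt_le_trans Tt0 Tt).
  have t_ge1 : 1 <= t by exact: le_trans T1 Tt.
  have tt : t0 < t by exact: lt_le_trans Tt.
  have ppm := pm _ tt; have gGt := gG _ (ltW tt).
  rewrite ode1// sE.
  set E := (t / v t) ^+ 2.
  have E_le : 2 * theta * E <= kappa.
    have EE : E = (g t / t) ^+ 2 by rewrite /E /g; congr (_ ^+ 2); field; rewrite v0 gt_eqF.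
    have E1 : E <= G ^+ 2 / t ^+ 2.
      rewrite EE expr_div_n ler_pM2r ?invr_gt0 ?exprn_gt0//.
      have g_ge0 : 0 <= g t by rewrite ltW// /g !mulr_gt0// invr_gt0.
      by rewrite ler_pXn2r ?nnegrE// ltW.
    have E2 : 2 * theta * G ^+ 2 / kappa <= t ^+ 2.
      have Tt' : 2 * theta * G ^+ 2 / kappa <= t by exact: le_trans Tt.
      by apply: le_trans Tt' _; rewrite expr2 ler_peMl// ltW.
    apply: (@le_trans _ _ (2 * theta * (G ^+ 2 / t ^+ 2))).
      by rewrite ler_wpM2l// mulr_ge0// ltW.
    rewrite mulrA ler_pdivrMr ?exprn_gt0//.
    by move: E2; rewrite ler_pdivrMr// [t ^+ 2 * _]mulrC.
  have E_ge0 : 0 <= E by rewrite /E sqr_ge0.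
  have q_le : b * q t <= - 2 * kappa * p t ^+ 2.
    have p2 : m ^+ 2 <= p t ^+ 2 by rewrite -[p t ^+ 2]sqrrN ler_pXn2r// ?nnegrE; lra.
    have q2 : q t <= - 2 * kappa * p t ^+ 2.
      have p2' : 1 <= p t ^+ 2 / m ^+ 2 by rewrite ler_pdivlMr ?mul1r// exprn_gt0//; lra.
      set P := p t ^+ 2 in p2' *; rewrite /q -/P.
      have kP : 4 * kappa * P = P - P / m ^+ 2 by rewrite kE; ring.
      by move: p2' kP; move: (P / m ^+ 2) => Z; lra.
    have q_le0 : q t <= 0.
      apply: le_trans q2 _; rewrite !mulNr oppr_le0 mulr_ge0 ?sqr_ge0// mulr_ge0//.
      exact: ltW.
    apply: le_trans q2; rewrite -subr_ge0 (_ : q t - b * q t = (1 - b) * q t); last by ring.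
    by rewrite mulr_le0//; lra.
  have s_le : - (E * (2 * theta * (p t + m))) <= kappa * p t ^+ 2.
    have Np1 : 1 <= - p t by lra.
    have A1 : - (E * (2 * theta * (p t + m))) <= 2 * theta * E * (- p t).
      rewrite -subr_ge0 (_ : _ - _ = 2 * theta * E * m); last by ring.
      exact: (mulr_ge0 (mulr_ge0 (mulr_ge0 (ler0n _ 2) (ltW theta_gt0)) E_ge0) (ltW m_gt0)).
    apply: (le_trans A1); apply: le_trans (_ : kappa * - p t <= _).
      by rewrite ler_wpM2r// (le_trans ler01).
    by rewrite ler_pM2l// -[p t ^+ 2]sqrrN expr2 ler_peMr// (le_trans ler01).
  apply: le_trans (lerD q_le s_le) _.
  by rewrite -subr_ge0 (_ : _ - _ = 0)//; ring.
have T_gt0 : 0 < T by exact: lt_trans Tt0.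
pose et r := T * expR r.
have etT r : 0 <= r -> T <= et r.
  by move=> r0; apply: ler_peMr; [exact: ltW|rewrite -expR0 ler_expR].
have det (r : R) : is_derive r 1 et (et r).
  have H := is_derive1M (is_derive1_cst T r) (is_derive1_expR (is_derive1_id r)).
  by apply: is_derive_eq H _; rewrite /et; ring.
have pet_lt r : 0 <= r -> p (et r) < -1.
  move=> /etT H; apply: lt_trans (pm _ (lt_le_trans Tt0 H)) _.
  by rewrite ltrN2.
(* In logarithmic time p satisfies the Riccati inequality p' <= - kappa p^2, so it
   would reach - oo before time 1 / kappa. *)
pose z r := (0 - p (et r)) * (1 - kappa * r) - 1.
pose dz r := (0 - p' (et r) * et r) * (1 - kappa * r) + (0 - p (et r)) * (0 - kappa).
have dzr (r : R) : is_derive r 1 z (dz r).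
  have d1 : is_derive r 1 (fun r => p (et r)) (p' (et r) * et r).
    exact: (@is_derive1_comp _ p et).
  have d2 := is_derive1B (is_derive1_cst 0 r) d1.
  have d3 := is_derive1M (is_derive1_cst kappa r) (is_derive1_id r).
  have d4 := is_derive1M d2 (is_derive1B (is_derive1_cst 1 r) d3).
  by apply: is_derive_eq (is_derive1B d4 (is_derive1_cst 1 r)) _; rewrite /dz; ring.
have k_inv : 0 < kappa^-1 by rewrite invr_gt0.
(* z > 0 says that - p exceeds 1 / (1 - kappa r), the solution of w' = kappa w^2 with w(0) = 1; at r
   = 1 / kappa this fails, as z = -1. *)
have z0 : 0 < z 0.
  have := pet_lt 0 (lexx _); rewrite /z mulr0 subr0 mulr1 sub0r => H.
  by rewrite subr_gt0 ltrNr.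
have z1 : z kappa^-1 <= 0.
  by rewrite /z mulfV ?gt_eqF// subrr mulr0 sub0r oppr_le0.
have [r [r0 rk zr zpos]] := first_zero (is_derive_continuous dzr) k_inv z0 z1.
have : z 0 <= z r.
  apply: (derive_ge0_le dzr (ltW r0)) => y /andP[y0 yr].
  have zy : 0 < z y by apply: zpos; rewrite ltW.
  have ky : 0 < 1 - kappa * y.
    by rewrite subr_gt0 mulrC -ltr_pdivlMr// mul1r (lt_le_trans yr).
  have H := p_growth _ (etT _ (ltW y0)).
  have H1 : kappa * p (et y) ^+ 2 <= 0 - p' (et y) * et y.
    have E : 0 - p' (et y) * et y = - (et y * p' (et y)) by ring.
    by rewrite E lerNr -mulNr.
  have H2 : 0 <= (0 - p' (et y) * et y - kappa * p (et y) ^+ 2) * (1 - kappa * y).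
    by apply: mulr_ge0; [rewrite subr_ge0|exact: ltW].
  have H3 : 0 <= kappa * (0 - p (et y)) * z y.
    rewrite mulr_ge0 ?ltW// mulr_gt0// sub0r oppr_gt0.
    by rewrite (lt_trans (pet_lt _ (ltW y0)))// oppr_lt0.
  (* A nonnegative defect of the Riccati inequality plus a positive multiple of z: z cannot decrease
     to zero. *)
  have -> : dz y = (0 - p' (et y) * et y - kappa * p (et y) ^+ 2) * (1 - kappa * y)
      + kappa * (0 - p (et y)) * z y by rewrite /dz /z; ring.
  exact: addr_ge0.
by rewrite zr leNgt z0.
Qed.

End FirstZero.

Lemma soliton_ode_pos t : 0 <= t -> 0 < s t.
Proof.
move=> t_ge0; rewrite ltNge; apply/negP => st.
have s0 : 0 < s 0 by move: s0_gt0; rewrite /s pE !mul0r subr0 mulr1 addrC.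
have t_gt0 : 0 < t.
  by rewrite lt_neqAle t_ge0 andbT; apply: contraTneq st => <-; rewrite -ltNge.
have [r [r_gt0 _ sr spos]] := first_zero (is_derive_continuous ds) t_gt0 s0 st.
have [K0|K0] := posnP K; first exact: (first_zero_absurd_1 r_gt0 sr spos K0).
exact: (first_zero_absurd_gt1 r_gt0 sr spos K0).
Qed.

End SolitonODE.

#[local] Opaque sigma_metric conf_schouten soliton_eq.

(** * Restriction to a coordinate axis *)

Section Axis.
Context (R : realType) (n : nat).
Implicit Types (x : 'rV[R]_n) (i j l : 'I_n).

Lemma sigma_diag2 (A : 'M[R]_n) i (a b : R) k :
  (forall j l, A j l = (j == l)%:R * (if j == i then a else b)) ->
  (k < n)%N ->
  sigma k.+1 A = 'C(n.-1, k.+1)%:R * b ^+ k.+1 + 'C(n.-1, k)%:R * (a * b ^+ k).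
Proof.
move=> AE kn.
have As : A^T = A by apply/matrixP => j l; rewrite mxE !AE eq_sym; case: eqP => [->|]; rewrite ?mul0r.
pose N := n.-1; pose P : {poly R} := ('X - b%:P) ^+ N.
have nN : n = N.+1 by rewrite /N prednK// (leq_ltn_trans _ kn).
have PE m : (m <= N)%N -> P`_(N - m) = (-1) ^+ m * ('C(N, m)%:R * b ^+ m).
  move=> mN; have := coef_prod_XsubC_sum (fun _ : 'I_N => b) mN.
  rewrite prodr_const card_ord => ->; congr (_ * _).
  rewrite (eq_bigr (fun=> b ^+ m)); last by move=> I /eqP <-; rewrite prodr_const.
  rewrite sumr_const [RHS]mulr_natl; congr (_ *+ _).
  rewrite -[in RHS](card_ord N) -card_draws; apply: eq_card => I.
  by rewrite !inE.
have charE : char_poly A = ('X - a%:P) * P.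
  rewrite char_poly_trig; last first.
    by apply/is_trig_mxP => j l jl; rewrite AE -val_eqE /= ltn_eqF// mul0r.
  rewrite (bigD1 i)//= AE !eqxx mul1r; congr (_ * _).
  rewrite (eq_bigr (fun=> 'X - b%:P)); last first.
    by move=> j /negPf ji; rewrite AE eqxx ji mul1r.
  rewrite prodr_const; congr (_ ^+ _).
  have <- : #|predC1 i| = N by rewrite cardC1 card_ord.
  by apply: eq_card => j; rewrite !inE.
rewrite sigma_sgn_coef// /sgn_coef charE.
have -> : (n - k.+1 = N - k)%N by rewrite nN subSS.
rewrite mulrBl coefB coefCM coefXM PE; last by rewrite -ltnS -nN.
rewrite mulrBr; congr (_ + _).
  (* For k = n - 1 the binomial is zero, and so is the constant coefficient of X P. *)
  have [kN|kN] := ltnP k N.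
    rewrite subn_eq0 leqNgt kN /= -subnS PE//.
    by rewrite mulrA -expr2 sqrr_sign mul1r.
  by rewrite subn_eq0 kN mulr0 bin_small// mul0r.
rewrite exprS mulN1r mulNr opprK (mulrCA _ a) (mulrA ((-1) ^+ k)) -expr2 sqrr_sign.
by rewrite mul1r mulrCA.
Qed.

Section AxisSchouten.
Implicit Types (f : 'rV[R]_n -> R) (t : R).
Variable i : 'I_n.

Definition axis (t : R) : 'rV[R]_n := t *: delta_mx 0 i.

Lemma axisE t j : axis t 0 j = (j == i)%:R * t.
Proof. by rewrite /axis !mxE eqxx /= mulrC. Qed.

Lemma is_derive_axis f t : smooth f ->
  is_derive t 1 (fun r => f (axis r)) (partial i f (axis t)).
Proof.
move=> sf; have df y : differentiable f y by exact: smooth_diff.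
have [dF FE] := is_derive_line 0 (delta_mx 0 i) t df.
have E : (fun r : R => f (0 + r *: delta_mx 0 i)) = fun r => f (axis r).
  by apply/funext => r; rewrite add0r.
rewrite E in dF FE; split; first exact: dF.
by rewrite FE add0r derive_delta.
Qed.

Lemma partial_axis f t j : smooth f -> rot_invariant f -> j != i ->
  partial j f (axis t) = 0.
Proof.
move=> sf fQ /negPf ji; have [->|t0] := eqVneq t 0.
  by rewrite /axis scale0r grad0.
have := partial_cross sf fQ j i (axis t); rewrite !axisE ji eqxx mul1r !mul0r => /eqP.
by rewrite mulf_eq0 (negPf t0) => /eqP.
Qed.

Lemma partial2_axis f t j l : smooth f -> rot_invariant f -> j != i ->
  t * partial l (partial j f) (axis t) = (l == j)%:R * partial i f (axis t).
Proof.
move=> sf fQ ji; have := partial_cross_diff sf fQ i j l (axis t).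
rewrite !axisE (negPf ji) eqxx mul1r !mul0r addr0 => ->.
by rewrite (partial_axis t sf fQ ji) mulr0 add0r.
Qed.

Lemma dot_grad_axis f t : smooth f -> rot_invariant f ->
  dot (axis t) (grad f (axis t)) = t * partial i f (axis t).
Proof.
move=> sf fQ; rewrite /axis dotZl dotC dot_delta [grad f _ 0 i]mxE.
by [].
Qed.

Variable v : 'rV[R]_n -> R.
Hypotheses (sv : smooth v) (vQ : rot_invariant v).

Lemma conf_schouten_axis t : 0 < t -> forall j l,
  conf_schouten v (axis t) j l = (j == l)%:R * (if j == i
    then v (axis t) * partial i (partial i v) (axis t) - partial i v (axis t) ^+ 2 / 2
    else v (axis t) * (partial i v (axis t) / t) - partial i v (axis t) ^+ 2 / 2).
Proof.
move=> t_gt0; have t0 : t != 0 by rewrite gt_eqF.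
have H j l : j != i -> hess v (axis t) j l = (l == j)%:R * (partial i v (axis t) / t).
  move=> ji; apply: (mulfI t0); rewrite mxE (partial2_axis t l sv vQ ji).
  by rewrite mulrCA [t * (_ / _)]mulrC divfK.
have G : dot (grad v (axis t)) (grad v (axis t)) = partial i v (axis t) ^+ 2.
  rewrite /dot (bigD1 i)//= big1 ?addr0; first by rewrite mxE expr2.
  by move=> j ji; rewrite [grad v _ 0 j]mxE partial_axis// mul0r.
move=> j l; have := conf_schouten_hess v j l (axis t); rewrite G => E.
have {E} -> : conf_schouten v (axis t) j l = v (axis t) * hess v (axis t) j l
    - partial i v (axis t) ^+ 2 / 2 * (j == l)%:R by rewrite E addrK.
have [ji|ji] := eqVneq j i; last by rewrite H// [l == j]eq_sym; ring.
rewrite ji; have [<-|li] := eqVneq i l; first by rewrite [hess v _ i i]mxE mulr1 mul1r.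
have -> : hess v (axis t) i l = 0.
  have /matrixP/(_ l i) := hess_sym (axis t) sv; rewrite mxE => ->.
  by rewrite H// ?(negPf li) ?mul0r// eq_sym.
by rewrite !(mulr0, mul0r) subrr.
Qed.

End AxisSchouten.
Section Positivity.
Variables (k : nat) (rho theta : R) (u : 'rV[R]_n -> R).
Hypotheses (n_ge3 : (3 <= n)%N) (k_le_n : (k < n)%N).
Hypotheses (u_gt0 : forall x, 0 < u x) (su : smooth u) (uQ : rot_invariant u).

Lemma conf_pow_rot : rot_invariant (conf_pow k.+1 u).
Proof. by move=> Q oQ x; rewrite /conf_pow uQ. Qed.

#[local] Opaque conf_pow.

Lemma sigma_metric_rot Q x : orthogonal Q ->
  sigma_metric k.+1 (conf_metric k.+1 u) (x *m Q) = sigma_metric k.+1 (conf_metric k.+1 u) x.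
Proof.
move=> oQ; rewrite (sigma_metricE n_ge3 k.+1 u_gt0 su x).
rewrite (sigma_metricE n_ge3 k.+1 u_gt0 su (x *m Q)).
exact: (sigma_conf_schouten_rot (smooth_conf_pow k.+1 u_gt0 su) conf_pow_rot).
Qed.

Lemma soliton_sigma_gt0 : 0 < 2 * theta + rho ->
  (forall x, soliton_eq k.+1 rho theta u x) ->
  forall x, 0 < sigma_metric k.+1 (conf_metric k.+1 u) x.
Proof.
move=> s0_gt0 eqx x.
have n0 : (0 < n)%N by exact: leq_trans n_ge3.
have i := Ordinal n0.
have [Q oQ xQ] := rotate_to_axis i x.
rewrite -(sigma_metric_rot x oQ) xQ -/(axis i _); have : 0 <= enorm x by exact: sqrtr_ge0.
move: (enorm x) => {x xQ oQ Q} r r_ge0.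
pose v := conf_pow k.+1 u.
have sv : smooth v by exact: smooth_conf_pow.
have v_gt0 y : 0 < v y by exact: conf_pow_gt0.
have vQ : rot_invariant v by exact: conf_pow_rot.
pose va t := v (axis i t).
pose v1 t := partial i v (axis i t).
pose v2 t := partial i (partial i v) (axis i t).
have va0 t : va t != 0 by exact: lt0r_neq0 (v_gt0 _).
pose p (t : R) : R := 1 - t * v1 t / va t.
pose p' t := - (v1 t / va t) - t * v2 t / va t + t * v1 t ^+ 2 / va t ^+ 2.
have dva (t : R) : is_derive t 1 va (v1 t) by exact: is_derive_axis.
have dv1 (t : R) : is_derive t 1 v1 (v2 t) by apply: is_derive_axis; exact: smooth_partial.
have dp (t : R) : is_derive t 1 p (p' t).
  have d1 := is_derive1M (is_derive1M (is_derive1_id t) (dv1 t)) (is_derive1V (va0 t) (dva t)).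
  apply: is_derive_eq (is_derive1B (is_derive1_cst 1 t) d1) _.
  by rewrite /p'; field.
have root t : is_kth_root k.+1 (sigma_metric k.+1 (conf_metric k.+1 u) (axis i t))
    (rho + 2 * theta * p t).
  have [H _] := soliton_eqE n_ge3 rho u_gt0 su k_le_n theta (axis i t).
  by have := H (eqx (axis i t)); rewrite -/v (dot_grad_axis i t sv vQ).
pose c := 'C(n.-1, k)%:R : R; pose b : R := 'C(n.-1, k.+1)%:R - c.
have c_gt0 : 0 < c by rewrite ltr0n bin_gt0 -ltnS prednK.
have bc : k = 0%N -> 1 <= b /\ c = 1.
  rewrite /b /c => ->; rewrite bin0 bin1; split=> //.
  by rewrite lerBrDr -[1 + 1]/(2%:R) ler_nat -ltnS prednK.
have ode (t : R) : 0 < t -> va t ^+ (2 * k.+1) *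
    (((1 - p t ^+ 2) / 2) ^+ k * (b * ((1 - p t ^+ 2) / 2) - c * (t * p' t))) =
    t ^+ (2 * k.+1) * (rho + 2 * theta * p t) ^+ k.+1.
  move=> t_gt0; have t0 : t != 0 by rewrite gt_eqF.
  have [-> _] := root t; rewrite (sigma_metricE n_ge3 k.+1 u_gt0 su).
  rewrite (sigma_diag2 (conf_schouten_axis i sv vQ t_gt0) k_le_n) -/v.
  rewrite -/(va t) -/(v1 t) -/(v2 t) -/c.
  set q := (1 - p t ^+ 2) / 2.
  have -> : va t * (v1 t / t) - v1 t ^+ 2 / 2 = va t ^+ 2 * q / t ^+ 2.
    by rewrite /q /p; field; rewrite t0 va0.
  have -> : va t * v2 t - v1 t ^+ 2 / 2 = va t ^+ 2 * (- (t * p' t) - q) / t ^+ 2.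
    by rewrite /q /p /p'; field; rewrite t0 va0.
  rewrite !exprM ![(va t ^+ 2 * q / t ^+ 2) ^+ _]exprMn ![(va t ^+ 2 * q) ^+ _]exprMn exprVn.
  rewrite exprVn /b; move: (va0 t) t0 => V0 T0.
  have V20 : va t ^+ 2 != 0 by rewrite expf_neq0.
  have T20 : t ^+ 2 != 0 by rewrite expf_neq0.
  move: (va t ^+ 2) (t ^+ 2) V20 T20 => V T V20 T20.
  rewrite !exprS; have Tk : T ^+ k != 0 by rewrite expf_neq0.
  by move: (V ^+ k) (T ^+ k) (q ^+ k) Tk => Vk Tk qk Tk0; field; rewrite T20 Tk0.
have pos := soliton_ode_pos dva (fun t => v_gt0 (axis i t)) (fun t => erefl (p t)) dp c_gt0 bc ode.
have [<- _] := root r; apply: exprn_gt0; apply: pos => //.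
by move=> k0 t t_gt0; have [_] := root t; apply.
Qed.

End Positivity.

End Axis.

(** * Solitons and the equation *)

Section MetricProperties.
Context (R : realType) (n : nat).
Implicit Types (x : 'rV[R]_n) (i j l : 'I_n).

Lemma is_metric_inv_sq (v : 'rV[R]_n -> R) : smooth v -> (forall y, 0 < v y) ->
  is_metric (inv_sq_metric v).
Proof.
move=> sv v_gt0; split.
- move=> i j.
  have -> : (fun x => inv_sq_metric v x i j) = (fun x => (v x ^+ 2)^-1 * (i == j)%:R).
    by apply/funext => y; rewrite mxE mulr_natr.
  by apply: smoothM; [exact: smooth_inv_sq|exact: smooth_cst].
- by move=> x; rewrite tr_scalar_mx.
- move=> x w w0; rewrite mul_mx_scalar -scalemxAl mxE -dotE mulr_gt0//.
    by rewrite invr_gt0 exprn_gt0.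
  by rewrite lt_neqAle dot_ge0 eq_sym dot_eq0 w0.
Qed.

Variables (k : nat) (u : 'rV[R]_n -> R).
Hypotheses (k_gt0 : (0 < k)%N) (n_gt0 : (0 < n)%N) (u_gt0 : forall x, 0 < u x).
Let b : R := 4 * k%:R / (n%:R + 2 * k%:R).

Let b_gt0 : 0 < b.
Proof. by rewrite /b divr_gt0 ?mulr_gt0 ?ltr0n// addr_gt0 ?mulr_gt0 ?ltr0n. Qed.

Lemma conf_metric_flat : smooth u -> conformally_flat (conf_metric k u).
Proof.
move=> su; exists (fun x => u x `^ b); split=> [|x|//]; first exact: smooth_powR.
exact: powR_gt0.
Qed.

Lemma conf_metric_rot : rot_invariant u -> rotationally_symmetric (conf_metric k u).
Proof.
move=> uQ Q oQ x; rewrite /conf_metric (uQ _ oQ) mul_mx_scalar -scalemxAl oQ.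
by rewrite scalemx1.
Qed.

Let scalar_mx_inj (a c : R) : a%:M = c%:M :> 'M[R]_n -> a = c.
Proof.
move=> /matrixP/(_ (Ordinal n_gt0) (Ordinal n_gt0)).
by rewrite !mxE eqxx !mulr1n.
Qed.

(** Smoothness of [u] is part of the conclusion; it is recovered from the conformal factor, a
    positive power of [u]. *)
Lemma conf_metric_flatP : conformally_flat (conf_metric k u) -> smooth u.
Proof.
move=> [w [sw w0 wE]].
have -> : u = fun x => w x `^ b^-1.
  apply/funext => x; have <- := scalar_mx_inj (wE x).
  by rewrite -/b -powRrM mulfV ?gt_eqF// powRr1// ltW.
exact: smooth_powR.
Qed.

Lemma conf_metric_rotP : rotationally_symmetric (conf_metric k u) -> rot_invariant u.
Proof.
move=> gQ Q oQ x; have := gQ Q oQ x.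
rewrite /conf_metric mul_mx_scalar -scalemxAl oQ scalemx1 => /scalar_mx_inj.
by apply: (powR_injective b_gt0); rewrite nnegrE ltW.
Qed.

End MetricProperties.

(** * From the equation to a soliton *)

Section SolitonOfEquation.
Context (R : realType) (n : nat).
Implicit Types (x : 'rV[R]_n) (i j l : 'I_n).
Variables (k : nat) (rho theta : R) (u : 'rV[R]_n -> R).
Hypotheses (n_ge3 : (3 <= n)%N) (k_le_n : (k <= n)%N).
Hypotheses (u_gt0 : forall x, 0 < u x) (su : smooth u) (uQ : rot_invariant u).

Lemma soliton_of_equation : (forall x, soliton_eq k rho theta u x) ->
  yamabe_gradient_soliton k rho (conf_metric k u).
Proof.
move=> eqx; pose v := conf_pow k u.
have sv : smooth v by exact: smooth_conf_pow.
have v_gt0 y : 0 < v y by exact: conf_pow_gt0.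
have vQ : rot_invariant v by move=> Q oQ x; rewrite /v /conf_pow uQ.
have n0 : (0 < n)%N by exact: leq_trans n_ge3.
have gE := conf_metricE n_ge3 k u; rewrite -/v in gE.
split; first by rewrite gE; exact: is_metric_inv_sq.
pose G x := 2 * theta * (v x ^+ 2)^-1.
have sG : smooth G by apply: smoothM; [exact: smooth_cst|exact: smooth_inv_sq].
have GQ : rot_invariant G by move=> Q oQ x; rewrite /G vQ.
have [phi sphi phiE] := radial_potential n0 sG GQ.
exists phi; split=> // x.
exists (rho + 2 * theta * (1 - dot x (grad v x) / v x)); split.
  by have [H _] := soliton_eqE n_ge3 rho u_gt0 su k_le_n theta x; exact: H.
have v0 : v x != 0 by exact: lt0r_neq0.
have dG j : partial j G x = - (4 * theta) * partial j v x / v x ^+ 3.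
  rewrite /G partialM; [|exact/smooth_diff/smooth_cst|exact/smooth_diff/smooth_inv_sq].
  by rewrite partial_cst partial_inv_sq//; field.
have d2 i j : partial j (partial i phi) x =
    (i == j)%:R * G x - x 0 i * (4 * theta) * partial j v x / v x ^+ 3.
  have -> : partial i phi = fun y => y 0 i * G y by apply/funext => y; exact: phiE.
  rewrite partialM; [|exact/smooth_diff/smooth_coord|exact/smooth_diff].
  by rewrite partial_coord dG; field.
have dvphi : \sum_l partial l v x * partial l phi x = G x * dot x (grad v x).
  rewrite /dot mulr_sumr; apply: eq_bigr => l _; rewrite phiE [grad v x 0 l]mxE.
  by ring.
apply/matrixP => i j; rewrite gE hess_metric_inv_sq// dvphi d2 !phiE.
rewrite mxE [inv_sq_metric v x i j]mxE -[_ *+ (i == j)]mulr_natr /G.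
have := partial_cross sv vQ i j x.
move: (dot x _) (partial i v x) (partial j v x) (x 0 i) (x 0 j) => D vi vj xi xj cross.
(* The Hessian differs from (s - rho) g by a multiple of x_j D_i v - x_i D_j v, which vanishes
   because v is radial. *)
transitivity (2 * theta * (1 - D / v x) * (v x ^+ 2)^-1 * (i == j)%:R
   + 2 * theta * (xj * vi - xi * vj) / v x ^+ 3).
  by rewrite cross subrr mulr0 mul0r addr0; ring.
by field.
Qed.

End SolitonOfEquation.

Section KthRoot.
Context (R : realType).
Implicit Types (b s r : R).

Lemma is_kth_root_gt0 k b s : (0 < k)%N -> 0 < b -> is_kth_root k b s -> 0 < s.
Proof.
move=> k0 b0 [sE s0]; have [k1|k1] := ltnP 1 k; last first.
  have kE : k = 1%N by apply/eqP; rewrite eqn_leq k1.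
  by rewrite -[s]expr1 -kE sE.
rewrite lt_neqAle s0// andbT eq_sym; apply: contraTneq b0 => s_eq0.
by rewrite -sE s_eq0 expr0n gtn_eqF// ltxx.
Qed.

Lemma is_kth_root_inj k b s r : (0 < k)%N -> 0 < b ->
  is_kth_root k b s -> is_kth_root k b r -> s = r.
Proof.
move=> k0 b0 sr rr; have s0 := is_kth_root_gt0 k0 b0 sr.
have r0 := is_kth_root_gt0 k0 b0 rr.
apply: (pexpIrn k0); rewrite ?nnegrE ?ltW//.
by have [-> _] := sr; have [-> _] := rr.
Qed.

End KthRoot.

(* The soliton equations along a ray: P and Q stand for the radial derivative
   and a tangential second derivative of the potential. *)
Section SolitonRay.
Context (R : realType).
Implicit Types t : R.
Variables (V V1 P P1 Q Q1 S : R -> R) (rho : R).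
Hypotheses (dV : forall t, is_derive t 1 V (V1 t)) (dP : forall t, is_derive t 1 P (P1 t))
  (dQ : forall t, is_derive t 1 Q (Q1 t)) (V0 : forall t, V t != 0).
Hypotheses (radial_eq : forall t, S t - rho = V t ^+ 2 * P1 t + V t * V1 t * P t)
  (tangential_eq : forall t, S t - rho = V t ^+ 2 * Q t - V t * V1 t * P t)
  (mixed_eq : forall t, t * (V t * Q1 t) + t * V1 t * Q t + V1 t * P t = 0).
Hypotheses (V_even : forall t, V (- t) = V t) (V1_odd : forall t, V1 (- t) = - V1 t)
  (S_even : forall t, S (- t) = S t).

(** Radial minus tangential equation gives V P' = V Q - 2 V' P; with the mixed equation the
    derivative of (t Q - P) V vanishes. In the flat case the constant is the linear part of the
    potential along the ray, up to sign. *)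
Let tQ_subP t s : (t * Q t - P t) * V t = (s * Q s - P s) * V s.
Proof.
pose E t := (t * Q t - P t) * V t.
have dE (r : R) : is_derive r 1 E 0.
  have d1 := is_derive1B (is_derive1M (is_derive1_id r) (dQ r)) (dP r).
  apply: is_derive_eq (is_derive1M d1 (dV r)) _.
  have H1 : V r * P1 r = V r * Q r - 2 * (V1 r * P r).
    apply: (mulfI (V0 r)); have := radial_eq r; rewrite tangential_eq => H.
    have -> : V r * (V r * P1 r) = V r ^+ 2 * P1 r + V r * V1 r * P r - V r * V1 r * P r by ring.
    by rewrite -H; ring.
  have H2 : r * (V r * Q1 r) = - (r * V1 r * Q r + V1 r * P r).
    by apply/eqP; rewrite -addr_eq0 addrA mixed_eq.
  transitivity (V r * Q r + r * (V r * Q1 r) - V r * P1 r + (r * Q r - P r) * V1 r); first by ring.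
  by rewrite H1 H2; ring.
have le (f : R -> R) : (forall r : R, is_derive r 1 f 0) -> forall a b, a <= b -> f a <= f b.
  by move=> df a b ab; apply: (derive_ge0_le df ab).
have dNE (r : R) : is_derive r 1 (fun r => 0 - E r) 0.
  by apply: is_derive_eq (is_derive1B (is_derive1_cst 0 r) (dE r)) _; rewrite subr0.
have H a b : a <= b -> E a = E b.
  move=> ab; apply/eqP; rewrite eq_le (le _ dE)//=.
  by have := le _ dNE _ _ ab; rewrite !sub0r lerN2.
by rewrite -!/(E _); have [/H|/ltW/H ->] := leP t s.
Qed.

Let Qt t := Q t + Q (- t).

Let tQt t : t * Qt t = P t - P (- t).
Proof.
have := tQ_subP t (- t); rewrite V_even => /(mulIf (V0 t)) E.
by rewrite /Qt mulrDr; move: E; rewrite mulNr => E; lra.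
Qed.

(** The mixed equations at t and -t show that t times the derivative is a multiple of t [Qt] - (P(t)
    - P(-t)), which is zero. *)
Let V2Qt t : 0 <= t -> V t ^+ 2 * Qt t = V 0 ^+ 2 * Qt 0.
Proof.
move=> t_ge0; pose H t := V t ^+ 2 * Qt t.
pose dH t := 2 * V t * V1 t * Qt t + V t ^+ 2 * (Q1 t - Q1 (- t)).
have dN (r : R) : is_derive r 1 (fun r : R => - r) (-1).
  by have := is_derive1B (is_derive1_cst 0 r) (is_derive1_id r); under eq_fun do rewrite sub0r; rewrite sub0r.
have dHr (r : R) : is_derive r 1 H (dH r).
  have d1 := is_derive1M (dV r) (dV r).
  have d2 : is_derive r 1 (fun s => Q (- s)) (Q1 (- r) * -1).
    exact: (@is_derive1_comp _ Q (fun s => - s)).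
  have := is_derive1M d1 (is_derive1D (dQ r) d2).
  by move=> d3; apply: is_derive_eq d3 _; rewrite /dH /Qt; ring.
have dH0 r : 0 < r -> dH r = 0.
  move=> r0; have r_neq0 : r != 0 by rewrite gt_eqF.
  apply: (mulfI r_neq0); rewrite mulr0.
  have M1 := mixed_eq r; have M2 := mixed_eq (- r); rewrite V_even V1_odd in M2.
  have -> : r * dH r = V r * (2 * (V1 r * (r * Qt r)) + (r * (V r * Q1 r)) + (- r * (V r * Q1 (- r)))).
    by rewrite /dH; ring.
  have -> : r * (V r * Q1 r) = - (r * V1 r * Q r + V1 r * P r).
    by apply/eqP; rewrite -addr_eq0 addrA M1.
  have -> : - r * (V r * Q1 (- r)) = - (- r * - V1 r * Q (- r) + - V1 r * P (- r)).
    by apply/eqP; rewrite -addr_eq0 addrA M2.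
  transitivity (V r * V1 r * (r * Qt r - (P r - P (- r)))); first by rewrite /Qt; ring.
  by rewrite tQt subrr mulr0.
apply/eqP; rewrite -/(H t) -/(H 0) eq_le; apply/andP; split.
- have dNH (r : R) : is_derive r 1 (fun r => 0 - H r) (0 - dH r).
    exact: is_derive1B (is_derive1_cst 0 r) (dHr r).
  have := derive_ge0_le dNH t_ge0; rewrite !sub0r lerN2; apply => r /andP[r0 _].
  by rewrite dH0// subrr.
- by apply: (derive_ge0_le dHr t_ge0) => r /andP[r0 _]; rewrite dH0.
Qed.

Lemma soliton_ray t : 0 <= t ->
  S t = rho + 2 * (V 0 ^+ 2 * Qt 0 / 4) * (1 - t * V1 t / V t).
Proof.
move=> t_ge0; rewrite -(V2Qt t_ge0).
have E1 := tangential_eq t; have E2 := tangential_eq (- t).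
rewrite S_even V_even V1_odd in E2.
(* The tangential equations at t and -t are averaged; this accounts for one factor 2 in the 4, the
   other comes from 2 theta. *)
have -> : S t = rho + ((S t - rho) + (S t - rho)) / 2 by field.
rewrite {1}E1 E2.
transitivity (rho + (V t ^+ 2 * Qt t - V t * V1 t * (P t - P (- t))) / 2).
  by rewrite /Qt; ring.
by rewrite -tQt; field.
Qed.

End SolitonRay.

(** a and b stand for second derivatives of v on the axis, which are known only after multiplication
    by t; no division at t = 0 occurs. *)
Lemma mixed_identity (R : comNzRingType) (t a b c V V1 P Q Q1 : R) :
  t * a = 0 -> t * b = V1 -> t * (V * Q1 + (a * c + V1 * Q) + b * P) = 0 ->
  t * (V * Q1) + t * V1 * Q + V1 * P = 0.
Proof.
move=> ta tb E; rewrite -[RHS]E.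
have -> : t * (V * Q1 + (a * c + V1 * Q) + b * P) =
  t * (V * Q1) + (t * a) * c + t * V1 * Q + (t * b) * P by ring.
by rewrite ta tb; ring.
Qed.

(** * From a soliton to the equation *)

Section EquationOfSoliton.
Context (R : realType) (n : nat).
Implicit Types (x : 'rV[R]_n) (i j l : 'I_n) (t : R).
Variables (v phi : 'rV[R]_n -> R) (S : 'rV[R]_n -> R) (rho : R).
Hypotheses (sv : smooth v) (v_gt0 : forall y, 0 < v y) (vQ : rot_invariant v).
Hypotheses (sphi : smooth phi) (SQ : rot_invariant S).
Hypothesis hessE : forall x, (S x - rho) *: inv_sq_metric v x =
  hess_metric (inv_sq_metric v) phi x.

Let v0 x : v x != 0. Proof. exact: lt0r_neq0. Qed.

Let hess_eq x i j : (S x - rho) * (i == j)%:R =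
  v x ^+ 2 * partial j (partial i phi) x
  - v x * ((i == j)%:R * (\sum_l partial l v x * partial l phi x)
           - partial i v x * partial j phi x - partial j v x * partial i phi x).
Proof.
have /matrixP/(_ i j) := hessE x; rewrite hess_metric_inv_sq// mxE.
rewrite [inv_sq_metric v x i j]mxE -[_ *+ (i == j)]mulr_natr => E.
apply: (mulIf (_ : (v x ^+ 2)^-1 != 0)); first by rewrite invr_eq0 expf_neq0.
have -> : (S x - rho) * (i == j)%:R * (v x ^+ 2)^-1 =
  (S x - rho) * ((v x ^+ 2)^-1 * (i == j)%:R) by ring.
by rewrite E; field.
Qed.

Lemma hess_off_diag x i j : i != j ->
  v x * partial j (partial i phi) x + partial i v x * partial j phi x
    + partial j v x * partial i phi x = 0.
Proof.
move=> /negPf ij; have := hess_eq x i j; rewrite ij mulr0 mul0r sub0r => E.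
apply: (mulfI (v0 x)); rewrite mulr0 [RHS]E; ring.
Qed.

Variables i j : 'I_n.
Hypothesis ij : j != i.
Let V t := v (axis i t).
Let V1 t := partial i v (axis i t).
Let P t := partial i phi (axis i t).
Let P1 t := partial i (partial i phi) (axis i t).
Let Q t := partial j (partial j phi) (axis i t).
Let Q1 t := partial i (partial j (partial j phi)) (axis i t).

Let dV t : is_derive t 1 V (V1 t). Proof. exact: is_derive_axis. Qed.

Let dP t : is_derive t 1 P (P1 t).
Proof. by apply: is_derive_axis; exact: smooth_partial. Qed.

Let dQ t : is_derive t 1 Q (Q1 t).
Proof. by apply: is_derive_axis; do 2 apply: smooth_partial. Qed.

Let V0 t : V t != 0. Proof. exact: v0. Qed.

Let grad_dot t : \sum_l partial l v (axis i t) * partial l phi (axis i t) = V1 t * P t.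
Proof.
rewrite (bigD1 i)//= big1 ?addr0// => l li.
by rewrite (partial_axis _ sv vQ li) mul0r.
Qed.

Let radial_eq t : S (axis i t) - rho = V t ^+ 2 * P1 t + V t * V1 t * P t.
Proof.
have := hess_eq (axis i t) i i; rewrite eqxx mulr1 mul1r grad_dot => ->.
by rewrite -/(V t) -/(V1 t) -/(P t) -/(P1 t); ring.
Qed.

Let tangential_eq t : S (axis i t) - rho = V t ^+ 2 * Q t - V t * V1 t * P t.
Proof.
have := hess_eq (axis i t) j j; rewrite eqxx mulr1 mul1r grad_dot => ->.
by rewrite (partial_axis _ sv vQ ij) -/(V t) -/(Q t); ring.
Qed.

(** The off-diagonal component (i, j) of the Hessian equation is differentiated in the tangential
    direction e_j, which turns its mixed derivative of phi into the derivative of Q along the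
    axis. *)
Let mixed_eq t : t * (V t * Q1 t) + t * V1 t * Q t + V1 t * P t = 0.
Proof.
pose f x := v x * partial j (partial i phi) x + partial i v x * partial j phi x
    + partial j v x * partial i phi x.
have f0 : f = fun=> 0 by apply/funext => x; apply: hess_off_diag; rewrite eq_sym.
have : partial j f (axis i t) = 0 by rewrite f0 partial_cst.
have s1 a : smooth (partial a phi) by exact: smooth_partial.
have s2 a : smooth (partial a v) by exact: smooth_partial.
have s3 : smooth (partial j (partial i phi)) by exact: smooth_partial.
rewrite /f partialD; last 2 first.
- by apply/smooth_diff/smoothD; exact: smoothM.
- by apply/smooth_diff/smoothM.
rewrite partialD; [|exact/smooth_diff/smoothM|exact/smooth_diff/smoothM].
rewrite !partialM; try exact: smooth_diff.
have -> : partial j (partial j (partial i phi)) (axis i t) = Q1 t.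
  have -> : partial j (partial i phi) = partial i (partial j phi).
    by apply/funext => y; exact: partialC.
  exact: partialC.
rewrite (partial_axis _ sv vQ ij) !mul0r add0r addr0.
move=> /(congr1 (fun z => t * z)); rewrite mulr0.
have A1 : t * partial j (partial i v) (axis i t) = 0.
  by rewrite partialC// (partial2_axis t i sv vQ ij) eq_sym (negPf ij) mul0r.
have A2 : t * partial j (partial j v) (axis i t) = V1 t.
  by rewrite (partial2_axis t j sv vQ ij) eqxx mul1r.
exact: (mixed_identity A1 A2).
Qed.

Let axisN t : axis i t *m (- 1%:M) = axis i (- t).
Proof. by rewrite /axis mulmxN mulmx1 scaleNr. Qed.

Let V_even t : V (- t) = V t.
Proof. by rewrite /V -axisN vQ//; exact: orthogonalN1. Qed.

Let S_even t : S (axis i (- t)) = S (axis i t).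
Proof. by rewrite -axisN SQ//; exact: orthogonalN1. Qed.

Let V1_odd t : V1 (- t) = - V1 t.
Proof.
have := partial_rot sv vQ i (axis i t) (orthogonalN1 R n); rewrite axisN -/(V1 t) => ->.
rewrite (bigD1 i)//= big1 ?addr0.
  by rewrite !mxE eqxx mulN1r opprK.
by move=> l /negPf li; rewrite !mxE eq_sym li oppr0 mul0r.
Qed.

Lemma soliton_axis t : 0 <= t ->
  S (axis i t) = rho + 2 * (V 0 ^+ 2 * (Q 0 + Q (- 0)) / 4) * (1 - t * V1 t / V t).
Proof.
exact: (@soliton_ray _ V V1 P P1 Q Q1 (fun t => S (axis i t)) rho dV dP dQ V0
  radial_eq tangential_eq mixed_eq V_even V1_odd S_even).
Qed.

End EquationOfSoliton.

#[local] Opaque soliton_div_eq conf_pow.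

Section SolitonEquation.
Context (R : realType) (n : nat).
Implicit Types (x : 'rV[R]_n).
Variables (k : nat) (rho : R) (u : 'rV[R]_n -> R).
Hypotheses (n_ge3 : (3 <= n)%N) (k_lt_n : (k < n)%N).
Hypotheses (u_gt0 : forall x, 0 < u x) (su : smooth u).

Let v := conf_pow k.+1 u.
Let sv : smooth v. Proof. exact: smooth_conf_pow. Qed.

Let v_gt0 y : 0 < v y. Proof. exact: conf_pow_gt0. Qed.

Definition soliton_speed (theta : R) x := rho + 2 * theta * (1 - dot x (grad v x) / v x).

Lemma equation_of_soliton : rot_invariant u ->
  yamabe_gradient_soliton k.+1 rho (conf_metric k.+1 u) ->
  (forall x, 0 < sigma_metric k.+1 (conf_metric k.+1 u) x) ->
  exists theta, 0 < 2 * theta + rho /\ forall x, soliton_eq k.+1 rho theta u x.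
Proof.
move=> uQ [_ [phi [sphi /choice[S HS]]]] s_gt0.
have vQ : rot_invariant v by exact: conf_pow_rot.
have gE := conf_metricE n_ge3 k.+1 u; rewrite -/v in gE.
have rootS x : is_kth_root k.+1 (sigma_metric k.+1 (conf_metric k.+1 u) x) (S x).
  by have [] := HS x.
(* Positive roots are unique, so S inherits the invariance of sigma_k although phi may lack it. *)
have SQ : rot_invariant S.
  move=> Q oQ x; have := rootS (x *m Q).
  rewrite (sigma_metric_rot k n_ge3 u_gt0 su uQ x oQ) => rQ.
  exact: is_kth_root_inj (s_gt0 x) rQ (rootS x).
have hE x : (S x - rho) *: inv_sq_metric v x = hess_metric (inv_sq_metric v) phi x.
  by rewrite -gE; have [] := HS x.
have n0 : (0 < n)%N by exact: leq_trans n_ge3.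
have n1 : (1 < n)%N by exact: leq_trans n_ge3.
pose i := Ordinal n0; pose j := Ordinal n1.
have ji : j != i by [].
have := soliton_axis sv v_gt0 vQ sphi SQ hE ji.
set theta := (X in 2 * X) => axE; exists theta.
have eqS x : S x = soliton_speed theta x.
  have [Q oQ xQ] := rotate_to_axis i x.
  rewrite -(SQ _ oQ) xQ -/(axis i _) axE ?sqrtr_ge0// /soliton_speed.
  by rewrite (dot_grad_rot sv vQ x oQ) -(vQ _ oQ x) xQ -/(axis i _) (dot_grad_axis _ _ sv vQ).
split.
  (* At the origin the speed equals 2 theta + rho. *)
  have := is_kth_root_gt0 (ltn0Sn k) (s_gt0 0) (rootS 0).
  rewrite eqS /soliton_speed {1}/dot big1 ?mul0r ?subr0 ?mulr1 1?addrC// => l _.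
  by rewrite mxE mul0r.
move=> x; have [_ H] := soliton_eqE n_ge3 rho u_gt0 su k_lt_n theta x.
by apply: H; have := rootS x; rewrite eqS.
Qed.

Lemma div_eq_of_soliton_eq theta x :
  soliton_eq k.+1 rho theta u x -> soliton_div_eq k.+1 rho theta u x.
Proof.
have [H _] := soliton_eqE n_ge3 rho u_gt0 su k_lt_n theta x.
have [_ D] := soliton_div_eqE n_ge3 rho (ltn0Sn k) u_gt0 su k_lt_n theta x.
by move=> /H[E _]; apply: D; rewrite E.
Qed.

Lemma soliton_speed_gt0 theta : 0 < 2 * theta + rho ->
  (forall x, soliton_speed theta x != 0) -> forall x, 0 < soliton_speed theta x.
Proof.
move=> s0 nz x; rewrite ltNge; apply/negP => sx.
have ss : smooth (soliton_speed theta).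
  apply: smoothD; first exact: smooth_cst.
  apply: smoothM; first exact: smooth_cst.
  apply: smoothB; first exact: smooth_cst.
  apply: smoothM; last exact: smoothV.
  apply: smooth_sum => l; apply: smoothM; first exact: smooth_coord.
  by under eq_fun do rewrite mxE; exact: smooth_partial.
pose f t := soliton_speed theta (0 + t *: x).
have df (t : R) := is_derive_line 0 x t (fun y => smooth_diff y ss).
have f0 : 0 < f 0.
  rewrite /f scale0r addr0 /soliton_speed {1}/dot big1 ?mul0r ?subr0 ?mulr1 1?addrC// => l _.
  by rewrite mxE mul0r.
have f1 : f 1 <= 0 by rewrite /f scale1r add0r.
have [t [_ _ ft _]] := first_zero (is_derive_continuous df) ltr01 f0 f1.
by have := nz (0 + t *: x); rewrite [soliton_speed _ _]ft eqxx.
Qed.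

Lemma soliton_eq_of_div_eq theta : 0 < 2 * theta + rho ->
  (forall x, 0 < sigma_metric k.+1 (conf_metric k.+1 u) x) ->
  (forall x, soliton_div_eq k.+1 rho theta u x) ->
  forall x, soliton_eq k.+1 rho theta u x.
Proof.
move=> s0 s_gt0 div.
have E x : sigma_metric k.+1 (conf_metric k.+1 u) x = soliton_speed theta x ^+ k.+1.
  have [D _] := soliton_div_eqE n_ge3 rho (ltn0Sn k) u_gt0 su k_lt_n theta x.
  exact: D.
have pos := soliton_speed_gt0 s0 _.
move=> x; have [_ H] := soliton_eqE n_ge3 rho u_gt0 su k_lt_n theta x.
apply: H; split; first by rewrite E.
move=> _; apply/ltW/pos => y.
by have := s_gt0 y; rewrite E; apply: contraTneq => ->; rewrite expr0n ltxx.
Qed.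

End SolitonEquation.

Theorem theorem1p1 (R : realType) (n k : nat) (rho : R)
    (hn : (3 <= n)%N) (hk : (1 <= k <= n)%N)
    (u : 'rV[R]_n -> R) (u_gt0 : forall x, 0 < u x) :
  ([/\ conformally_flat (conf_metric k u),
       rotationally_symmetric (conf_metric k u),
       yamabe_gradient_soliton k rho (conf_metric k u) &
       forall x, 0 < sigma_metric k (conf_metric k u) x]
   <->
   [/\ smooth u, radial u &
       exists theta : R, 0 < 2 * theta + rho /\
         forall x, soliton_eq k rho theta u x])
  /\
  (smooth u -> forall theta : R, 0 < 2 * theta + rho ->
     ((forall x, soliton_eq k rho theta u x) ->
      forall x, soliton_div_eq k rho theta u x)
     /\
     ((forall x, 0 < sigma_metric k (conf_metric k u) x) ->
      (forall x, soliton_div_eq k rho theta u x) ->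
      forall x, soliton_eq k rho theta u x)).
Proof.
have n0 : (0 < n)%N by exact: leq_trans hn.
have radialP := radial_rot_invariant u n0.
case: k hk => [//|k] /= kn; split; last first.
  move=> su theta s0; split=> [eqx x|]; first exact: div_eq_of_soliton_eq.
  exact: soliton_eq_of_div_eq.
split=> [[flat rot sol s_gt0]|[su /radialP uQ [theta [s0 eqx]]]].
  have su := conf_metric_flatP (ltn0Sn k) n0 u_gt0 flat.
  have uQ := conf_metric_rotP (ltn0Sn k) n0 u_gt0 rot.
  by split; [exact: su|exact/radialP|exact: equation_of_soliton].
split.
- exact: conf_metric_flat.
- exact: conf_metric_rot.
- exact: soliton_of_equation eqx.
- exact: soliton_sigma_gt0 eqx.
Qed.
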